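(* Let $\Bbbk$ be a field, let $G$ be a well-covered finite simple graph on $\{x_1,\dots,x_n\}$, and let $S=\Bbbk[x_1,\dots,x_n]$. Then $$S_{2}\text{-}\mathrm{depth}(S/I(G)^{(\ell)})\geq S_{2}\text{-}\mathrm{depth}(S/I(G)^{(\ell+1)})\quad\text{for all }\ell\ge 1.$$
   Context: $\mathfrak m=(x_1,\dots,x_n)$ and $\omega_S$ is the canonical module of $S$. For an unmixed finitely generated graded $S$-module $M$ and $r\ge 2$, $S_r\text{-}\mathrm{depth}(M)=\min\{j : \dim K_M^j\ge j-r+1\}$, where $K_M^j=\mathrm{Hom}_{\Bbbk}(H^j_{\mathfrak m}(M),\Bbbk)\cong \mathrm{Ext}_S^{n-j}(M,\omega_S)$, $\dim$ is Krull dimension, and $\dim 0=-\infty$. The edge ideal of $G$ is $I(G)=(x_ix_j : \{x_i,x_j\}\in E(G))\subset S$. $G$ is well-covered if all minimal vertex covers of $G$ have the same cardinality (equivalently $I(G)$ is unmixed). For a squarefree monomial ideal $I$, the $\ell$-th symbolic power is $I^{(\ell)}=\bigcap_{P\in\mathrm{Ass}(I)}P^\ell$. *)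

(* Defs.v *)
From HB Require Import structures.
From mathcomp Require Import all_boot all_order all_algebra.
From mathcomp Require Import boolp.
From mathcomp Require Import mpoly.

Set Implicit Arguments.
Unset Strict Implicit.
Unset Printing Implicit Defensive.

Import Order.TTheory GRing.Theory Num.Theory.
Local Open Scope ring_scope.

Local Notation "x %:F" := (FracField.tofrac x) : ring_scope.

Section Ideals.
Variable S : comNzRingType.
Implicit Types (I P : {pred S}) (X : S -> Prop).

Definition ideal_span X : {pred S} := [pred p : S |
  `[< exists (m : nat) (a x : 'I_m -> S),
        (forall i, X (x i)) /\ p = \sum_(i < m) a i * x i >]].

Definition ideal_power I (l : nat) : {pred S} :=
  ideal_span (fun p => exists u : 'I_l -> S,
    (forall i, u i \in I) /\ p = \prod_(i < l) u i).

Definition prime_ideal P : Prop := idealr_closed P /\ prime_idealr_closed P.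

(* P belongs to Ass(S/I): P is prime and P = (I : f) for some f. *)
Definition associated_prime I P : Prop :=
  prime_ideal P /\ exists f : S, forall g : S, (g \in P) = (g * f \in I).

(* This is the definition of I^(l) for a squarefree monomial ideal I. *)
Definition symbolic_power I (l : nat) : {pred S} := [pred p : S |
  `[< forall P : {pred S}, associated_prime I P -> p \in ideal_power P l >]].

(* For a finitely generated S-module N with annihilator A, this says that
   c <= dim N, where dim N is the supremum of the lengths of the chains of
   primes containing A.  It is false for every c when N = 0, in accordance
   with dim 0 = -oo. *)
Definition krull_dim_ge (A : {pred S}) (c : int) : Prop :=
  exists (d : nat) (p : nat -> {pred S}),
    [/\ c <= d%:Z,
        forall i : nat, (i <= d)%N -> prime_ideal (p i) /\ {subset A <= p i} &
        forall i : nat, (i < d)%N ->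
          {subset p i <= p i.+1} /\ ~ {subset p i.+1 <= p i}].

End Ideals.

(* Local cohomology of S/I at the ideal (x_1, ..., x_n), by the Cech complex
     C^j(S/I) = \bigoplus_(#|F| = j) (S/I)_(x_F),
   where x_F is the product of the x_i with i in F.  The localization
   (S/I)_(x_F) is represented as S_(x_F) / I S_(x_F), with S_(x_F) inside the
   fraction field of S. *)
Section LocalCohomology.
Variables (k : fieldType) (n : nat).
Notation S := {mpoly k[n]}.
Implicit Types (I J : {pred S}) (F : {set 'I_n}) (j : int).

Definition xprod F : S := \prod_(i in F) 'X_i.

(* J S_(x_F) *)
Definition loc_ideal J F (f : {fraction S}) : Prop :=
  exists2 g : S, g \in J & exists t : nat, f = g%:F / (xprod F)%:F ^+ t.

(* The component at F is required to vanish unless #|F| = j. *)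
Definition cochain := {ffun {set 'I_n} -> {fraction S}}.

Definition cech J j (c : cochain) : Prop :=
  forall F, if #|F|%:Z == j then loc_ideal J F (c F) else c F = 0.

Definition cech_diff (c : cochain) : cochain :=
  [ffun F : {set 'I_n} =>
    \sum_(i in F) (-1) ^+ #|[set h in F | (h < i)%N]| * c (F :\ i)].

Definition cscale (s : S) (c : cochain) : cochain :=
  [ffun F : {set 'I_n} => s%:F * c F].

(* Lifts to C^j(S) of the cocycles and coboundaries of C^j(S/I); the module
   H^j(S/I) is the quotient of cocycle I j by coboundary I j. *)
Definition cocycle I j (c : cochain) : Prop :=
  cech predT j c /\ cech I (j + 1) (cech_diff c).

Definition coboundary I j (c : cochain) : Prop :=
  exists b e : cochain,
    [/\ cech predT (j - 1) b, cech I j e & c = cech_diff b + e].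

(* Standard grading of S_(x_F).  Zero is homogeneous of every degree; it is a
   separate case because S_(x_F) with F = set0 has no representation
   g / x_F ^ t of negative degree. *)
Definition loc_homog F (d : int) (f : {fraction S}) : Prop :=
  f = 0 \/ exists (g : S) (m t : nat),
    [/\ g \is m.-homog, f = g%:F / (xprod F)%:F ^+ t
      & d = m%:Z - (t * #|F|)%N%:Z].

Definition cochain_homog (d : int) (c : cochain) : Prop :=
  forall F, loc_homog F d (c F).

(* Elements of K^j = Hom_k(H^j(S/I), k), the graded k-dual: k-linear forms on
   H^j(S/I) that vanish on all but finitely many graded components.  Only the
   values of phi on cocycles are meaningful. *)
Definition in_canonical_dual I j (phi : cochain -> k) : Prop :=
  [/\ forall (a : k) (c c' : cochain), cocycle I j c -> cocycle I j c' ->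
        phi (cscale a%:MP c + c') = a * phi c + phi c',
      forall c : cochain, coboundary I j c -> phi c = 0
    & exists N : nat, forall (d : int) (c : cochain), N%:Z < `|d| ->
        cocycle I j c -> cochain_homog d c -> phi c = 0].

(* The annihilator of K^j, where S acts by (s phi)(c) = phi (s c). *)
Definition ann_canonical_dual I j : {pred S} := [pred s : S |
  `[< forall phi : cochain -> k, in_canonical_dual I j phi ->
        forall c : cochain, cocycle I j c -> phi (cscale s c) = 0 >]].

(* S_r-depth(S/I) = min {j | dim K^j >= j - r + 1}.  As K^j = 0 for j > n, the
   minimum is over 0 <= j <= n; the value n + 1 stands for the minimum of the
   empty set. *)
Definition Sr_depth I (r : nat) : nat :=
  \big[minn/n.+1]_(j < n.+1 |
    `[< krull_dim_ge (ann_canonical_dual I j%:Z) (j%:Z - r%:Z + 1) >]) j.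

End LocalCohomology.

Section Graphs.
Variable n : nat.
Implicit Type e : rel 'I_n.

Definition vertex_cover e (C : {set 'I_n}) : bool :=
  [forall i, forall j, e i j ==> (i \in C) || (j \in C)].

Definition well_covered e : Prop :=
  forall C D : {set 'I_n}, minset (vertex_cover e) C ->
    minset (vertex_cover e) D -> #|C| = #|D|.

Definition edge_ideal (k : fieldType) e : {pred {mpoly k[n]}} :=
  ideal_span (fun p => exists i j : 'I_n, e i j /\ p = 'X_i * 'X_j).

End Graphs.
Arguments edge_ideal {n} k e.

(* Main.v *)
Require Import Defs.
From mathcomp Require Import mpoly.
From mathcomp Require Import all_boot all_order all_algebra.
From mathcomp Require Import boolp zify ring.

(* A symbolic power J_l = I(G)^(l) is the monomial ideal of the x^m with
   m(C) >= l for every minimal vertex cover C.  In a degree a in Z^n with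
   negative support A, the Cech complex of S/J_l is a cochain complex of the
   simplicial complex generated by the H \ A, where H runs over the maximal
   independent sets containing A with a(V \ H) < l (Takayama).  Hence
   dim K^j >= j - 1 exactly when some A of size j is a maximal independent set,
   or some A of size j - 1 and some a give a disconnected complex.  The first
   case does not depend on l.  In the second one, take H1 and H2 in different
   components; a vertex v1 of H1 \ A is not in H2, so it has a neighbour w in
   H2.  Adding 1 to a at v1 and at w increases a(V \ H1) and a(V \ H2) by 1 and
   every a(V \ H) by at least 1, because V \ H covers the edge v1 w: so the
   complex stays disconnected for l + 1. *)

Set Implicit Arguments.
Unset Strict Implicit.
Unset Printing Implicit Defensive.

Import GRing.Theory.
Local Open Scope ring_scope.

Local Notation "x %:F" := (FracField.tofrac x) : ring_scope.

(** * Monomial ideals *)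

Section MonomialIdeals.
Variables (k : fieldType) (n : nat).
Notation S := {mpoly k[n]}.
Notation mon := 'X_{1..n}.
Implicit Types (M : pred mon) (p q : S) (m : mon) (C : {set 'I_n}).

(** Two sizes of A suffice because, in a degree with negative support A, the Cech cohomology in
    degree j is the reduced cohomology of the degree complex in degree j - |A| - 1. A nonzero class
    there can be divided by any monomial in the variables of A, by lowering a on A; so the
    annihilator of K^j lies in the prime generated by the variables off A, and dim K^j >= |A|.
    Conversely, if there is no cohomology for |A| >= j - 1, a prime containing the annihilator
    misses at most j - 2 variables, and chains starting there have length at most j - 2. As
    cohomology starts in degree -1, only |A| = j and |A| = j - 1 are left: the complex {∅} and
    disconnected complexes, both handled with explicit cochains. The bound on chains of primes comes
    from an algebraic relation among elements chosen along the chain. *)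

Definition mon_ideal M : {pred S} := [pred p : S | all M (msupp p)].

Definition upclosed M := forall m m', M m -> M (m + m')%MM.

Lemma mon_idealP M p :
  reflect (forall m, p@_m != 0 -> M m) (p \in mon_ideal M).
Proof.
apply: (iffP allP) => h m; first by rewrite -mcoeff_msupp; exact: h.
by rewrite mcoeff_msupp; exact: h.
Qed.

Lemma mon_ideal0 M : 0 \in mon_ideal M.
Proof. by apply/mon_idealP => m; rewrite mcoeff0 eqxx. Qed.

Lemma mon_idealD M : {in mon_ideal M &, forall p q, p + q \in mon_ideal M}.
Proof.
move=> p q /allP hp /allP hq; apply/allP => m /msuppD_le.
by rewrite mem_cat => /orP[/hp|/hq].
Qed.

Lemma mon_ideal_sum M (I : Type) (r : seq I) (P : pred I) (F : I -> S) :
  (forall i, P i -> F i \in mon_ideal M) ->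
  \sum_(i <- r | P i) F i \in mon_ideal M.
Proof.
by move=> h; elim/big_ind: _ => //; [exact: mon_ideal0 | exact: mon_idealD].
Qed.

Lemma mon_idealMl M p q : upclosed M -> q \in mon_ideal M ->
  p * q \in mon_ideal M.
Proof.
move=> Mup /allP hq; apply/allP => m /msuppM_le /allpairsP[[m1 m2] /=].
by case=> _ m2q ->; rewrite addmC; apply/Mup/hq.
Qed.

Lemma mon_idealX M m : ('X_[m] \in mon_ideal M) = M m.
Proof. by rewrite inE /= msuppX /= andbT. Qed.

Lemma mon_idealZX M (a : k) m : M m -> a *: 'X_[m] \in mon_ideal M.
Proof.
move=> Mm; apply/mon_idealP => m'; rewrite mcoeffZ mcoeffX.
by case: (eqVneq m m') => [<-//|_]; rewrite mulr0 eqxx.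
Qed.

Lemma span_sub_mon_ideal M (X : S -> Prop) : upclosed M ->
  (forall p, X p -> p \in mon_ideal M) ->
  {subset ideal_span X <= mon_ideal M}.
Proof.
move=> Mup hX p /asboolP[r [a [x [hx ->]]]].
by apply: mon_ideal_sum => i _; apply: mon_idealMl => //; exact/hX.
Qed.

Lemma mon_ideal_sub_span M (X : S -> Prop) :
  (forall m, M m -> exists w x : S, X x /\ 'X_[m] = w * x :> S) ->
  {subset mon_ideal M <= ideal_span X}.
Proof.
move=> hX p /allP hp; apply/asboolP.
have h (i : 'I_(size (msupp p))) : exists wx : S * S,
    X wx.2 /\ 'X_[nth 0%MM (msupp p) i] = wx.1 * wx.2 :> S.
  have [w [x hwx]] := hX _ (hp _ (mem_nth 0%MM (ltn_ord i))).
  by exists (w, x).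
have [f hf] := fin_all_exists h.
exists (size (msupp p)).
exists (fun i : 'I__ => p@_(nth 0%MM (msupp p) i) *: (f i).1).
exists (fun i => (f i).2); split=> [i|]; first by case: (hf i).
rewrite [LHS]mpolyE (big_nth 0%MM) big_mkord; apply: eq_bigr => i _.
by rewrite -scalerAl; case: (hf i) => _ ->.
Qed.

Definition mdegin C m := (\sum_(i in C) m i)%N.

Lemma mdeginD C m1 m2 : mdegin C (m1 + m2) = (mdegin C m1 + mdegin C m2)%N.
Proof. by rewrite -big_split; apply: eq_bigr => i _; rewrite mnmDE. Qed.

Lemma mdeginU C i : mdegin C U_(i) = (i \in C).
Proof.
rewrite /mdegin; under eq_bigr do rewrite mnm1E.
rewrite big_mkcond (bigD1 i) //= eqxx big1 ?addn0; first by case: (i \in C).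
by move=> h /negPf hi; rewrite eq_sym hi; case: (h \in C).
Qed.

Lemma leq_mdegin C m i : i \in C -> (m i <= mdegin C m)%N.
Proof. by move=> iC; rewrite /mdegin (bigD1 i) //= leq_addr. Qed.

Lemma mdegin_gt0 C m : (0 < mdegin C m)%N -> exists2 i, i \in C & (0 < m i)%N.
Proof.
move=> h; have [/existsP[i /andP[]]|/existsPn h'] :=
  boolP [exists i, (i \in C) && (0 < m i)%N]; first by exists i.
move: h; rewrite /mdegin big1 // => i iC; apply/eqP.
by have := h' i; rewrite iC lt0n negbK.
Qed.

(** The l-th power of the prime generated by the variables of C, described by its monomials so that
    membership is a degree condition; [ideal_power_var] is the comparison. *)
Definition var_power C l : {pred S} := mon_ideal (fun m => l <= mdegin C m)%N.

Lemma upclosed_mdegin C l : upclosed (fun m => l <= mdegin C m)%N.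
Proof. by move=> m m' h; rewrite mdeginD (leq_trans h) ?leq_addr. Qed.

Lemma var_powerM C a b p q : p \in var_power C a -> q \in var_power C b ->
  p * q \in var_power C (a + b).
Proof.
move=> /allP hp /allP hq; apply/allP => m /msuppM_le /allpairsP[[m1 m2] /=].
by case=> m1p m2q ->; rewrite mdeginD leq_add ?hp ?hq.
Qed.

(** Setting the variables of C to 0 is a ring morphism into a domain; its kernel is therefore
    prime. *)
Lemma var_power1E C p : (p \in var_power C 1) =
  (mmap (@mpolyC n k) (fun i => if i \in C then 0 else 'X_i) p == 0).
Proof.
rewrite /mmap; set F := fun m => _.
have E m : (p@_m)%:MP * mmap1 (fun i => if i \in C then 0 else 'X_i : S) m =
    if (0 < mdegin C m)%N then 0 else p@_m *: 'X_[m].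
  case: ifPn => [/mdegin_gt0[i iC mi]|h].
    rewrite /mmap1 (bigD1 i) //= iC -[m i]prednK // exprS !mul0r ?mulr0 //.
  rewrite mul_mpolyC mpolyXE_id; congr (_ *: _); apply: eq_bigr => i _.
  case: ifPn => // iC; suff -> : m i = 0%N by rewrite !expr0.
  by move: h (leq_mdegin m iC); lia.
apply/idP/eqP => [/allP h|h].
  by rewrite big_seq big1 // => m mp; rewrite E h.
apply/mon_idealP => m pm; apply: contraTT pm => hm; rewrite negbK.
have := congr1 (mcoeff m) h; rewrite mcoeff0 raddf_sum /= => <-.
have [mp|mp] := boolP (m \in msupp p); last first.
  rewrite memN_msupp_eq0 // big_seq big1 // => m' m'p; rewrite E.
  case: ifP => _; rewrite ?mcoeff0 // mcoeffZ mcoeffX.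
  by case: (eqVneq m' m) => [e|_]; [rewrite -e m'p in mp | rewrite mulr0].
rewrite (bigD1_seq m) ?msupp_uniq //= E (negPf hm) mcoeffZ mcoeffX eqxx mulr1.
rewrite big1 ?addr0 // => m' m'm; rewrite E.
case: ifP => _; rewrite ?mcoeff0 // mcoeffZ mcoeffX (negPf m'm) mulr0 //.
Qed.

Lemma prime_var_power1 C : prime_ideal (var_power C 1).
Proof.
split; [split|].
- exact: mon_ideal0.
- rewrite -(mpolyX0 n k) mon_idealX /mdegin big1 // => i _; exact: mnm0E.
- move=> a p q hp hq; apply: mon_idealD => //; apply: mon_idealMl => //.
  exact: upclosed_mdegin.
by move=> p q; rewrite !var_power1E rmorphM mulf_eq0.
Qed.

Lemma ideal_powerE (P P' : {pred S}) l :
  P =i P' -> ideal_power P l =i ideal_power P' l.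
Proof.
move=> h p; rewrite !inE; apply: asbool_equiv_eq.
split=> [[m [a [x [hx ->]]]]|[m [a [x [hx ->]]]]]; exists m, a, x; split=> // i;
  by have [u [hu ->]] := hx i; exists u; split=> // j; rewrite ?h // -h.
Qed.

Lemma ideal_power_var C l : ideal_power (var_power C 1) l =i var_power C l.
Proof.
move=> p; apply/idP/idP; move: p.
  apply: span_sub_mon_ideal => [|p [u [hu ->]]]; first exact: upclosed_mdegin.
  suff: \prod_(i < l) u i \in var_power C (\sum_(i < l) 1).
    by rewrite sum1_card card_ord.
  elim/big_ind2: _ => // [|p1 a p2 b]; last exact: var_powerM.
  by rewrite -(mpolyX0 n k) mon_idealX.
apply: mon_ideal_sub_span => m; elim: l m => [|l IHl] m hm.
  exists 'X_[m], 1; rewrite mulr1; split=> //.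
  by exists (fun=> 0); split=> [[]//|]; rewrite big_ord0.
have [i iC mi] := mdegin_gt0 (leq_trans (ltn0Sn l) hm).
have hmi : (U_(i) <= m)%MM by rewrite lep1mP -lt0n.
have mE := submK hmi.
move: hm; rewrite -{1}mE mdeginD mdeginU iC addn1 ltnS.
case/IHl => w [x [[u [hu ->]] hw]].
exists w, (\prod_(j < l.+1) if unlift ord0 j is Some j' then u j' else 'X_i).
split; last first.
  rewrite big_ord_recl unlift_none mulrCA -{1}mE mpolyXD hw mulrC.
  by congr (_ * (_ * _)); apply: eq_bigr => j _; rewrite liftK.
eexists; split; last by [].
move=> j /=; case: (unlift ord0 j) => [j'|] //.
by rewrite mon_idealX mdeginU iC.
Qed.

End MonomialIdeals.

Section Ideals.
Variable R : comNzRingType.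
Implicit Types (P : {pred R}).

Lemma ideal_sum P (I : Type) (r : seq I) (Q : pred I) (F : I -> R) :
  idealr_closed P -> (forall i, Q i -> F i \in P) ->
  \sum_(i <- r | Q i) F i \in P.
Proof.
case=> P0 _ PD hF; elim/big_ind: _ => // x y xP yP.
by rewrite -[x]mul1r PD.
Qed.

Lemma idealMl P (a x : R) : idealr_closed P -> x \in P -> a * x \in P.
Proof. by case=> P0 _ PD xP; rewrite -[_ * _]addr0 PD. Qed.

Lemma idealD P (x y : R) : idealr_closed P -> x \in P -> y \in P -> x + y \in P.
Proof. by case=> P0 _ PD xP yP; rewrite -[x]mul1r PD. Qed.

Lemma prime_ideal_prod P (I : finType) (Q : pred I) (F : I -> R) :
  prime_ideal P -> \prod_(i | Q i) F i \in P -> exists2 i, Q i & F i \in P.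
Proof.
case=> [[_ P1 _] Pmul]; apply: contraPP => /forall2NP h.
apply/negP; elim/big_ind: _ => // [x y hx hy|i Qi].
  by apply/negP => /Pmul/orP[]; exact/negP.
by case: (h i) => // /negP.
Qed.

Lemma prime_idealX P (x : R) m : prime_ideal P -> x ^+ m \in P -> x \in P.
Proof.
case=> [[_ P1 _] Pmul]; elim: m => [|m IHm]; first by rewrite expr0 (negPf P1).
by rewrite exprS => /Pmul/orP[|/IHm].
Qed.

End Ideals.

Lemma var_power1_sub (k : fieldType) (n : nat) (C : {set 'I_n})
    (P : {pred {mpoly k[n]}}) :
  idealr_closed P -> {in C, forall i, 'X_i \in P} ->
  {subset var_power C 1 <= P}.
Proof.
move=> Pid hC p /allP hp; rewrite [p]mpolyE big_seq.
apply: ideal_sum => // m /hp/mdegin_gt0[i iC mi].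
have hmi : (U_(i) <= m)%MM by rewrite lep1mP -lt0n.
by rewrite -(submK hmi) mpolyXD scalerAl; apply: idealMl => //; exact: hC.
Qed.

(** * Symbolic powers of edge ideals *)

Section Covers.
Variables (n : nat) (e : rel 'I_n).
Implicit Types (C F : {set 'I_n}).

Definition mincover C := minset (vertex_cover e) C.

Lemma mincover_edge C i j : mincover C -> e i j -> (i \in C) || (j \in C).
Proof. by case/minsetP => /forallP/(_ i)/forallP/(_ j)/implyP h _ /h. Qed.

(** If all neighbours of i were in C, then C without i would still be a cover. *)
Lemma mincover_private C i : symmetric e -> irreflexive e -> mincover C ->
  i \in C -> exists2 j, e i j & j \notin C.
Proof.
move=> e_sym e_irr /minsetP[Ccov Cmin] iC.
have [/existsP[j /andP[]]|/existsPn h] :=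
  boolP [exists j, e i j && (j \notin C)].
  by exists j.
suff : C :\ i = C by move/setP/(_ i); rewrite !inE eqxx iC.
apply: Cmin; last exact: subD1set.
apply/forallP => a; apply/forallP => b; apply/implyP => eab.
have := h a; have := h b.
have /implyP/(_ eab) := forallP (forallP Ccov a) b; rewrite !inE.
case: (eqVneq a i) (eqVneq b i) => [ai|_] [bi|_] //=.
- by rewrite ai bi e_irr in eab.
- by move=> _; rewrite -ai eab /= negbK.
- by rewrite orbF => _ _; rewrite -bi e_sym eab /= negbK.
Qed.

Lemma sub_mincover C : vertex_cover e C ->
  exists2 D, mincover D & D \subset C.
Proof. by move=> h; have [D] := minset_exists h; exists D. Qed.

End Covers.

Section SymbolicPowers.
Variables (k : fieldType) (n : nat) (e : rel 'I_n).
Hypotheses (e_sym : symmetric e) (e_irr : irreflexive e).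
Notation S := {mpoly k[n]}.
Notation mon := 'X_{1..n}.
Implicit Types (m : mon) (C : {set 'I_n}) (p : S).

Definition sym_mon l m : bool :=
  [forall C : {set 'I_n}, mincover e C ==> (l <= mdegin C m)%N].

Lemma sym_monP l m :
  reflect (forall C, mincover e C -> (l <= mdegin C m)%N) (sym_mon l m).
Proof.
by apply: (iffP forallP) => h C; [have /implyP := h C | apply/implyP/h].
Qed.

Lemma upclosed_sym_mon l : upclosed (sym_mon l).
Proof.
move=> m m' /sym_monP h; apply/sym_monP => C /h; exact: upclosed_mdegin.
Qed.

Lemma edge_idealE : edge_ideal k e =i mon_ideal (sym_mon 1).
Proof.
move=> p; apply/idP/idP; move: p.
  apply: span_sub_mon_ideal => [|p [i [j [eij ->]]]].
    exact: upclosed_sym_mon.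
  rewrite -mpolyXD mon_idealX; apply/sym_monP => C /mincover_edge/(_ eij).
  by rewrite mdeginD !mdeginU; case: (i \in C); case: (j \in C).
apply: mon_ideal_sub_span => m /sym_monP hm.
have [/existsP[i /existsP[j /and3P[eij mi mj]]]|/existsPn h] :=
  boolP [exists i, exists j, [&& e i j, 0 < m i & 0 < m j]%N].
  exists 'X_[m - (U_(i) + U_(j))], ('X_i * 'X_j); split; first by exists i, j.
  rewrite -mpolyXD -mpolyXD submK //; apply/mnm_lepP => h.
  rewrite mnmDE !mnm1E; case: (eqVneq i h) => [<-|_].
    rewrite (_ : (j == i) = false) ?addn0 //; apply/eqP => ji.
    by rewrite ji e_irr in eij.
  by case: eqP => [<-|].
have [|C /hm /mdegin_gt0[i iC mi] /subsetP/(_ i iC)] :=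
    @sub_mincover _ e [set i | m i == 0%N].
  apply/forallP => i; apply/forallP => j; apply/implyP => eij.
  have := h i => /existsPn/(_ j); rewrite eij !inE /=; lia.
by rewrite inE; move: mi; case: (m i).
Qed.

Lemma edge_ideal_bigcap p : p \in edge_ideal k e <->
  forall C, mincover e C -> p \in var_power C 1.
Proof.
rewrite edge_idealE; split=> [/mon_idealP h C hC|h].
  by apply/mon_idealP => m /h/sym_monP; exact.
apply/mon_idealP => m pm; apply/sym_monP => C /h/mon_idealP; exact.
Qed.

(** Write P = (I : f). If some cover C with f outside P_C has all its variables in P, then P = P_C.
    Otherwise each cover C with f outside P_C has a variable outside P; the product of these
    variables, times f, lies in every P_C, hence in I, so the product is in P, against primality. *)
Lemma associated_prime_edge_ideal (P : {pred S}) :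
  associated_prime (edge_ideal k e) P <->
  exists2 C, mincover e C & P =i var_power C 1.
Proof.
split=> [[Pprime [f hf]]|[C hC hP]]; last first.
  split.
    have [[h0 h1 hD] hM] := prime_var_power1 k C.
    by split=> [|u v]; [split=> [||a u v]|]; rewrite !hP //;
      [exact: hD | exact: hM].
  (* The product of the variables off C: its product with a variable i of C is divisible by the edge
     from i to a neighbour outside C. *)
  exists 'X_[[multinom (i \notin C : nat) | i < n]] => g; rewrite hP.
  set mC := [multinom _ | i < n].
  have mC0 : 'X_[mC] \notin var_power (k := k) C 1.
    rewrite mon_idealX -leqNgt /mdegin leqn0 big1 // => i iC.
    by rewrite mnmE iC.
  apply/idP/idP => [gC|/edge_ideal_bigcap/(_ C hC)]; last first.
    by move/(prime_var_power1 k C).2; rewrite (negPf mC0) orbF.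
  rewrite edge_idealE; apply/mon_idealP => m; rewrite -mcoeff_msupp.
  rewrite (perm_mem (msuppMX _ _)) => /mapP[m' m'g ->].
  have /mdegin_gt0[i iC m'i] := allP gC _ m'g.
  have [j eij jC] := mincover_private e_sym e_irr hC iC.
  apply/sym_monP => D /mincover_edge/(_ eij)/orP[] iD.
    by apply: leq_trans (leq_mdegin _ iD); rewrite mnmDE ltn_addl.
  by apply: leq_trans (leq_mdegin _ iD); rewrite mnmDE mnmE jC.
have [[P0 P1 PD] PM] := Pprime.
have [/existsP[C /and3P[hC fC /subsetP sC]]|/existsPn h] := boolP [exists C,
  [&& mincover e C, f \notin var_power C 1
    & C \subset [set i | 'X_i \in P]]].
  exists C => // g; apply/idP/idP.
    rewrite hf => /edge_ideal_bigcap/(_ C hC)/(prime_var_power1 k C).2.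
    by rewrite (negPf fC) orbF.
  by apply: var_power1_sub g => [|i /sC]; rewrite ?inE.
have hD (D : {set 'I_n}) : exists g : S,
    (mincover e D && (f \notin var_power D 1)) ==>
    ((g \in var_power D 1) && (g \notin P)).
  have [/andP[hD fD]|_] := boolP (_ && _); last by exists 0.
  have /subsetPn[i iD] : ~~ (D \subset [set i | 'X_i \in P]).
    by have := h D; rewrite hD fD.
  by rewrite inE => iP; exists 'X_i; rewrite mon_idealX mdeginU iD.
have [G hG] := fin_all_exists hD.
pose Q D := mincover e D && (f \notin var_power D 1).
have /(prime_ideal_prod Pprime)[D QD] : \prod_(D | Q D) G D \in P.
  rewrite hf; apply/edge_ideal_bigcap => C hC.
  have [fC|fC] := boolP (f \in var_power C 1).
    by apply: mon_idealMl => //; exact: upclosed_mdegin.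
  have QC : Q C by rewrite /Q hC.
  rewrite (bigD1 C) //= -mulrA mulrC; apply: mon_idealMl.
    exact: upclosed_mdegin.
  by have /implyP/(_ QC)/andP[] := hG C.
by have /implyP/(_ QD)/andP[_ /negPf ->] := hG D.
Qed.

Lemma symbolic_powerE l :
  symbolic_power (edge_ideal k e) l =i mon_ideal (sym_mon l).
Proof.
move=> p; apply/asboolP/mon_idealP => [h m pm|h P].
  apply/sym_monP => C hC; move: m pm; apply/mon_idealP.
  rewrite -[mon_ideal _]/(var_power C l) -ideal_power_var; apply: h.
  by apply/associated_prime_edge_ideal; exists C.
case/associated_prime_edge_ideal => C hC /ideal_powerE ->.
rewrite ideal_power_var; apply/mon_idealP => m /h/sym_monP; exact.
Qed.

End SymbolicPowers.

(** * Krull dimension of polynomial rings *)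

Section KrullBound.
Variables (k : fieldType) (n : nat).
Notation S := {mpoly k[n]}.
Implicit Types (ys : seq S) (N : nat).

(** Reading r in base N indexes the monomials in ys with exponents below N by the integers below
    [N ^ size ys]. *)
Fixpoint digit_prod ys N r : S :=
  if ys is y :: ys' then y ^+ (r %% N)%N * digit_prod ys' N (r %/ N)%N else 1.

(* Values at ys of nonzero polynomials over k, written by factoring out the
   lowest power of each variable in turn.  This is the form in which a relation
   contradicts a chain of primes (Coquand and Lombardi). *)
Fixpoint nonzero_value ys (z : S) : Prop :=
  if ys is y :: ys' then exists (a : nat) (z0 w : S),
    nonzero_value ys' z0 /\ z = y ^+ a * (z0 + y * w)
  else exists2 c : k, c != 0 & z = c%:MP.

(** If y^a (z0 + y w) were in p 0, primality would remove y^a; since p 0 is contained in p 1 and y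
    is in p 1, z0 would be in p 1, against the induction hypothesis for the chain starting at p 1.
    At the end of the list, a nonzero constant is a unit. *)
Lemma nonzero_value_chain ys z (p : nat -> {pred S}) :
  (forall i, (i <= size ys)%N -> prime_ideal (p i)) ->
  (forall i, (i < size ys)%N -> [/\ {subset p i <= p i.+1},
      nth 0 ys i \in p i.+1 & nth 0 ys i \notin p i]) ->
  nonzero_value ys z -> z \notin p 0%N.
Proof.
elim: ys z p => [|y ys IHys] z p /= p_prime p_chain.
  case=> c c0 ->; have [p0id _] := p_prime 0%N isT; have [_ p01 _] := p0id.
  apply: contraNN p01 => /(idealMl c^-1%:MP p0id).
  by rewrite -mpolyCM mulVf // mpolyC1.
case=> a [z0 [w [/IHys IH ->]]].
have [sub yp1 yp0] := p_chain 0%N isT.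
have p0prime := p_prime 0%N isT; have [p0id p0M] := p0prime.
have [p1id _] := p_prime 1%N isT.
apply/negP => /p0M/orP[/(prime_idealX p0prime)|]; first exact/negP.
move=> /sub /(idealD p1id (idealMl (- w) p1id yp1)).
rewrite mulNr [w * y]mulrC addrCA addNr addr0; apply/negP.
by apply: (IH (fun i => p i.+1)) => i hi; [exact: p_prime | exact: p_chain].
Qed.

Lemma big_ord_mul (R : nmodType) M N (F : nat -> R) :
  \sum_(r < M * N) F r = \sum_(i < N) \sum_(r < M) F (r * N + i)%N.
Proof.
elim: M => [|M IHM].
  by rewrite mul0n big_ord0 big1 // => i _; rewrite big_ord0.
rewrite mulSn addnC big_split_ord /= IHM -big_split /=.
by apply: eq_bigr => i _; rewrite big_ord_recr.
Qed.

Lemma nonzero_value_comb ys N (q : nat -> k) r :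
  (r < N ^ size ys)%N -> q r != 0 ->
  nonzero_value ys (\sum_(i < N ^ size ys) (q i)%:MP * digit_prod ys N i).
Proof.
elim: ys q r => [|y ys IHys] q r /=.
  rewrite expn0 ltnS leqn0 => /eqP -> q0; exists (q 0%N) => //.
  by rewrite big_ord1 mulr1.
rewrite expnS mulnC => hr qr.
have N0 : (0 < N)%N by rewrite lt0n; apply: contraTneq hr => ->; rewrite muln0.
pose z i := \sum_(r < N ^ size ys) (q (r * N + i)%N)%:MP * digit_prod ys N r.
pose P i := [exists r : 'I_(N ^ size ys), (i < N)%N && (q (r * N + i)%N != 0)].
have exP : exists i, P i.
  exists (r %% N)%N; apply/existsP.
  have hr' : (r %/ N < N ^ size ys)%N by rewrite ltn_divLR.
  by exists (Ordinal hr'); rewrite /= ltn_mod N0 -divn_eq.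
(* The lowest exponent of y carrying a nonzero coefficient; [z i] is the coefficient of y^i. *)
have [a /existsP[b /andP[aN qab]] amin] := ex_minnP exP.
exists a, (z a), (\sum_(i < N | (a < i)%N) y ^+ (i - a.+1) * z i); split.
  exact: (IHys (fun r => q (r * N + a)%N) b).
rewrite (big_ord_mul _ _ (fun i => (q i)%:MP *
   (y ^+ (i %% N)%N * digit_prod ys N (i %/ N)%N))).
rewrite (bigID (fun i : 'I_N => (a < i)%N)) /= addrC mulrDr; congr (_ + _).
  rewrite (bigD1 (Ordinal aN)) ?ltnn //= [X in _ + X]big1 ?addr0.
    rewrite mulr_sumr; apply: eq_bigr => i _.
    by rewrite modnMDl divnMDl // modn_small // divn_small // addn0 mulrCA.
  move=> i /andP[ia /negPf ian]; rewrite big1 // => s _.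
  suff -> : q (s * N + i)%N = 0 by rewrite mul0r.
  apply/eqP; apply: contraT => qi; have := amin i; rewrite /P.
  have -> : [exists r0 : 'I_(N ^ size ys),
      (i < N)%N && (q (r0 * N + i)%N != 0)].
    by apply/existsP; exists s; rewrite ltn_ord.
  move=> /(_ isT); rewrite leq_eqVlt (negPf ia) orbF => /eqP ai.
  by move/eqP: ian; case; apply: val_inj.
rewrite mulrA -exprSr mulr_sumr; apply: eq_bigr => i ai.
rewrite mulrA -exprD subnKC // mulr_sumr; apply: eq_bigr => s _.
by rewrite modnMDl divnMDl // modn_small // divn_small // addn0 mulrCA.
Qed.

Variable W : {set 'I_n}.

Definition msupp_bounded E (p : S) := forall m, m \in msupp p ->
  (mdeg m <= E)%N /\ forall i, i \notin W -> m i = 0%N.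

Lemma msupp_bounded1 E : msupp_bounded E 1.
Proof.
by move=> m; rewrite msupp1 inE => /eqP ->; rewrite mdeg0; split=> // i;
  rewrite mnm0E.
Qed.

Lemma msupp_boundedM E E' p q : msupp_bounded E p -> msupp_bounded E' q ->
  msupp_bounded (E + E') (p * q).
Proof.
move=> hp hq m /msuppM_le /allpairsP[[m1 m2] /=].
case=> /hp[h1 h1'] /hq[h2 h2'] ->; rewrite mdegD leq_add //.
by split=> // i iW; rewrite mnmDE h1' ?h2'.
Qed.

Lemma msupp_boundedW E E' p : (E <= E')%N -> msupp_bounded E p ->
  msupp_bounded E' p.
Proof. by move=> EE' h m /h[hm ?]; split=> //; apply: leq_trans EE'. Qed.

Lemma msupp_boundedX E p a :
  msupp_bounded E p -> msupp_bounded (a * E) (p ^+ a).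
Proof.
move=> hp; elim: a => [|a IHa]; first exact: msupp_bounded1.
by rewrite exprS mulSn; apply: msupp_boundedM.
Qed.

Lemma msupp_bounded_digit_prod D ys N r : (0 < N)%N ->
  (forall y, y \in ys -> msupp_bounded D y) ->
  msupp_bounded (size ys * (N * D)) (digit_prod ys N r).
Proof.
move=> N0; elim: ys r => [|y ys IHys] r hys /=; first exact: msupp_bounded1.
rewrite mulSn; apply: msupp_boundedM; last first.
  by apply: IHys => z zys; apply: hys; rewrite inE zys orbT.
apply: (@msupp_boundedW ((r %% N)%N * D)).
  by rewrite leq_mul2r (ltnW (ltn_pmod _ _)) ?orbT.
by apply: msupp_boundedX; apply: hys; rewrite mem_head.
Qed.

Lemma msupp_bounded_exists ys :
  (forall y, y \in ys ->
     forall m, m \in msupp y -> forall i, i \notin W -> m i = 0%N) ->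
  exists D, forall y, y \in ys -> msupp_bounded D y.
Proof.
move=> h; exists (\max_(y <- ys) msize y)%N => y yys m my.
split; last exact: h my.
by rewrite (leq_trans (ltnW (msize_mdeg_lt my))) // leq_bigmax_seq.
Qed.

(** A monomial of degree at most E in the variables of W has all exponents at most E, so the
    coefficient matrix of the [z i] needs only [E.+1 ^ #|W|] columns; having more rows than columns,
    it has a nonzero left kernel. *)
Lemma comb_eq0 E K (z : 'I_K -> S) : (E.+1 ^ #|W| < K)%N ->
  (forall i, msupp_bounded E (z i)) ->
  exists2 v : 'rV[k]_K, v != 0 & \sum_i (v 0 i)%:MP * z i = 0.
Proof.
move=> hK hz.
pose J := pffun_on (ord0 : 'I_E.+1) (mem W) predT.
pose mo (f : {ffun 'I_n -> 'I_E.+1}) : 'X_{1..n} :=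
  [multinom (f i : nat) | i < n].
pose A : 'M[k]_(K, #|J|) := \matrix_(i, j) (z i)@_(mo (enum_val j)).
have cardJ : #|J| = (E.+1 ^ #|W|)%N by rewrite card_pffun_on card_ord.
have /rowV0Pn[v vA v0] : kermx A != 0.
  rewrite -mxrank_eq0 mxrank_ker -lt0n subn_gt0.
  by apply: leq_ltn_trans hK; rewrite -cardJ rank_leq_col.
exists v => //; apply/mpolyP => m; rewrite mcoeff0 raddf_sum /=.
have [/andP[mE /forallP mW]|hm] :=
    boolP ((mdeg m <= E)%N && [forall i, (i \notin W) ==> (m i == 0%N)]).
  have hmi i : (m i < E.+1)%N.
    by rewrite ltnS; apply: leq_trans mE; rewrite mdegE (bigD1 i) //= leq_addr.
  pose f := [ffun i => inord (m i) : 'I_E.+1].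
  have fJ : f \in J.
    apply/pffun_onP; split=> //; apply/subsetP => i; rewrite !inE ffunE.
    apply: contraR => iW; have := mW i; rewrite iW /= => /eqP ->.
    by apply/eqP/val_inj; rewrite /= inordK.
  have := congr1 (fun B : 'rV_#|J| => B 0 (enum_rank_in fJ f)) (sub_kermxP vA).
  rewrite !mxE => {2}<-; apply: eq_bigr => i _.
  rewrite mcoeffCM !mxE enum_rankK_in //; congr (_ * _@_ _).
  by apply/mnmP => j; rewrite mnmE ffunE inordK.
rewrite big1 // => i _; rewrite mcoeffCM memN_msupp_eq0 ?mulr0 //.
apply: contraNN hm => /hz[-> hW]; apply/forallP => j; apply/implyP => /hW ->.
by [].
Qed.

(* The N ^ size ys products of powers below N of the ys have degree linear in N,
   hence lie in a space of dimension O(N ^ #|W|). *)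
Lemma nonzero_value0 ys : (#|W| < size ys)%N ->
  (forall y, y \in ys ->
     forall m, m \in msupp y -> forall i, i \notin W -> m i = 0%N) ->
  nonzero_value ys 0.
Proof.
move=> Wys /msupp_bounded_exists[D hD].
(* For this N and E = d N D, (E + 1)^|W| <= (d D + 1)^|W| N^|W| < N^(|W| + 1) <= N^d. *)
pose d := size ys; pose N := ((d * D).+1 ^ #|W|).+1.
have N0 : (0 < N)%N by [].
pose E := (d * (N * D))%N.
have hK : (E.+1 ^ #|W| < N ^ d)%N.
  apply: (@leq_ltn_trans (((d * D).+1 * N) ^ #|W|)).
    by case: (#|W|) => // w; rewrite leq_exp2r // /E; lia.
  rewrite expnMn; apply: (@leq_trans (N * N ^ #|W|)).
    by rewrite ltn_pmul2r ?expn_gt0.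
  by rewrite -expnS leq_exp2l // ltnS expn_gt0.
have [v /rV0Pn[i vi] sum0] := comb_eq0 hK
   (fun i : 'I_(N ^ d) => msupp_bounded_digit_prod (r := i) N0 hD).
pose q r := oapp (v 0) 0 (insub r : option 'I_(N ^ d)).
have qE (j : 'I_(N ^ d)) : q j = v 0 j by rewrite /q valK.
rewrite -sum0; under eq_bigr do rewrite -qE.
by apply: (@nonzero_value_comb _ _ _ i) => //; rewrite qE.
Qed.

(** Terms involving a variable off W lie in p 0, so an element of p (i + 1) outside p i can be
    chosen in the variables of W alone. More than |W| such elements satisfy a relation, which would
    put 0 outside p 0. *)
Theorem krull_dim_bound (p : nat -> {pred S}) d :
  (forall i, (i <= d)%N -> prime_ideal (p i)) ->
  (forall i, (i < d)%N -> {subset p i <= p i.+1} /\ ~ {subset p i.+1 <= p i}) ->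
  (forall i, i \notin W -> 'X_i \in p 0%N) ->
  (d <= #|W|)%N.
Proof.
move=> p_prime p_chain pW; rewrite leqNgt; apply/negP => Wd.
pose insideW (m : 'X_{1..n}) := [forall i, (i \notin W) ==> (m i == 0%N)].
have sub0 i : (i <= d)%N -> {subset p 0%N <= p i}.
  elim: i => [_ x //|i IHi hi x /(IHi (ltnW hi))]; exact: (p_chain i hi).1.
have hy (i : 'I_d) : exists y, [/\ y \in p i.+1, y \notin p i
    & forall m, m \in msupp y -> insideW m].
  have [sub nsub] := p_chain i (ltn_ord i).
  have [y yp1 yp] : exists2 y, y \in p i.+1 & y \notin p i.
    apply: contrapT => /forall2NP h; apply: nsub => x xp1.
    by case: (h x) => // /negP; rewrite negbK.
  pose y1 := \sum_(m <- msupp y | insideW m) y@_m *: 'X_[m].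
  pose y2 := \sum_(m <- msupp y | ~~ insideW m) y@_m *: 'X_[m].
  have yE : y = y1 + y2 by rewrite [LHS]mpolyE (bigID insideW).
  have y2p0 : y2 \in p 0%N.
    apply: (@var_power1_sub _ _ (~: W)) => [|j|].
      by have [] := p_prime 0%N isT.
      by rewrite inE => /pW.
    apply: mon_ideal_sum => m; rewrite negb_forall => /existsP[j].
    rewrite negb_imply => /andP[jW mj]; apply: mon_idealZX.
    by apply: leq_trans (leq_mdegin _ (_ : j \in ~: W)); rewrite ?inE // lt0n.
  have pid a : (a <= d)%N -> idealr_closed (p a) by move=> /p_prime[].
  exists y1; split.
  - have -> : y1 = y + (-1) * y2 by rewrite yE mulN1r addrK.
    apply: idealD => //; first exact: pid.
    by apply: idealMl; [exact: pid | apply: sub0].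
  - apply: contraNN yp => y1p; rewrite yE; apply: idealD => //.
      by apply: pid; rewrite ltnW.
    by apply: sub0 => //; rewrite ltnW.
  - apply/allP; apply: (@mon_ideal_sum _ _ insideW) => m hm.
    exact: mon_idealZX.
have [f hf] := fin_all_exists hy.
pose ys := codom f.
have size_ys : size ys = d by rewrite size_codom card_ord.
have : nonzero_value ys 0.
  apply: nonzero_value0; first by rewrite size_ys.
  move=> _ /codomP[i ->] m; have [_ _ hi] := hf i.
  by move=> /hi/forallP h j jW; apply/eqP; have := h j; rewrite jW.
move/(nonzero_value_chain (p := p)) => /=.
have -> : 0 \in p 0%N by have [[]] := p_prime 0%N isT.
rewrite size_ys => h; suff: false by []; apply: h => // i hi.
have [sub _] := p_chain i hi; have [h1 h2 _] := hf (Ordinal hi).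
suff -> : nth 0 ys i = f (Ordinal hi) by [].
rewrite /ys codomE (nth_map (Ordinal hi)) ?size_enum_ord //.
by rewrite (nth_ord_enum _ (Ordinal hi)).
Qed.

End KrullBound.

(** * Degree complexes *)

Lemma disjoint_setU1 (T : finType) (C F : {set T}) i :
  [disjoint C & i |: F] = (i \notin C) && [disjoint C & F].
Proof.
rewrite disjoints_subset setCU subsetI -!disjoints_subset.
by rewrite disjoint_sym disjoints1.
Qed.

Lemma card_succ_sub (T : finType) (A F : {set T}) :
  A \subset F -> #|F| = #|A|.+1 -> exists2 v, v \notin A & F = v |: A.
Proof.
move=> AF hF; have /cards1P[v hv] : #|F :\: A| == 1.
  by rewrite cardsDS // hF subSnn.
exists v.
  by have : v \in F :\: A by [rewrite hv set11]; rewrite inE => /andP[].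
by rewrite -hv setUC setDE setUIr setUCr setIT; apply/esym/setUidPr.
Qed.

(** * Simplicial cochains, as functions on all subsets of the vertices *)

Section SimplicialCochains.
Variables (R : comNzRingType) (n : nat).
Implicit Types (F : {set 'I_n}) (beta : {set 'I_n} -> R).

Definition below (i : 'I_n) F := #|[set h in F | (h < i)%N]|.

Lemma below_rem i h F : i \in F -> below h F = ((i < h) + below h (F :\ i))%N.
Proof.
move=> iF; rewrite /below (cardsD1 i) !inE iF /=; congr (_ + _)%N.
by apply: eq_card => a; rewrite !inE andbA.
Qed.

Definition codiff beta F : R :=
  \sum_(i in F) (-1) ^+ below i F * beta (F :\ i).

Lemma codiff_codiff beta F : codiff (codiff beta) F = 0.
Proof.
pose T i h :=
  (-1) ^+ below i F * ((-1) ^+ below h (F :\ i) * beta (F :\ i :\ h)).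
have -> : codiff (codiff beta) F =
    \sum_(i in F) \sum_(h in F | (h < i)%N) T i h +
    \sum_(i in F) \sum_(h in F | (i < h)%N) T i h.
  rewrite -big_split; apply: eq_bigr => i iF; rewrite /codiff mulr_sumr.
  rewrite (bigID (fun h : 'I_n => (h < i)%N)) /=; congr (_ + _);
    apply: eq_bigl => h; rewrite !inE -val_eqE /=;
    case: (h \in F); rewrite ?andbF //=; lia.
rewrite [X in _ + X](exchange_big_dep (mem F)) /=; last by move=> i h _ /andP[].
rewrite -big_split big1 //= => i iF.
rewrite [X in _ + X](eq_bigl (fun h => (h \in F) && (h < i)%N)); last first.
  by move=> h; rewrite iF.
rewrite -big_split big1 //= => h.
case/andP => hF hi; rewrite /T setDDl setUC -setDDl.
rewrite (below_rem i hF) (below_rem h iF) hi ltnNge (ltnW hi) add1n exprS /=.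
by ring.
Qed.

Lemma codiffB beta beta' F :
  codiff (fun G => beta G - beta' G) F = codiff beta F - codiff beta' F.
Proof.
by rewrite /codiff -sumrB; apply: eq_bigr => i _; rewrite mulrBr.
Qed.

Lemma codiffZ a beta F : codiff (fun G => a * beta G) F = a * codiff beta F.
Proof. by rewrite /codiff mulr_sumr; apply: eq_bigr => i _; rewrite mulrCA. Qed.

Lemma codiff_single beta F i : i \in F ->
  (forall h, h \in F -> h != i -> beta (F :\ h) = 0) ->
  codiff beta F = (-1) ^+ below i F * beta (F :\ i).
Proof.
move=> iF h; rewrite /codiff (bigD1 i) //= big1 ?addr0 // => a /andP[aF ai].
by rewrite h ?mulr0.
Qed.

Lemma codiff_eq0 beta F : (forall i, i \in F -> beta (F :\ i) = 0) ->
  codiff beta F = 0.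
Proof. by move=> h; rewrite /codiff big1 // => i /h ->; rewrite mulr0. Qed.

End SimplicialCochains.

(** * Cohomology in a single multidegree *)

Section Degrees.
Variables (n : nat) (e : rel 'I_n).
Hypotheses (e_sym : symmetric e) (e_irr : irreflexive e).
Implicit Types (A B C F U : {set 'I_n}) (b : 'I_n -> nat).

(* A degree a in Z^n is given by the set A of its negative coordinates and by
   b = max(a, 0) off A; then in_loc says that x^a lies in J_l S_(x_F). *)
Definition in_loc l A b F : bool := (A \subset F) &&
  [forall C : {set 'I_n}, mincover e C && [disjoint C & F] ==>
     (l <= \sum_(i in C) b i)%N].

Lemma in_locP l A b F : reflect (A \subset F /\
    forall C, mincover e C -> [disjoint C & F] -> (l <= \sum_(i in C) b i)%N)
  (in_loc l A b F).
Proof.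
apply: (iffP andP) => [[AF /forallP h]|[AF h]]; split=> //.
  by move=> C hC CF; have := h C; rewrite hC CF.
by apply/forallP => C; apply/implyP => /andP[]; exact: h.
Qed.

Lemma in_locS l A A' b b' F : A' \subset A -> (forall i, b i <= b' i)%N ->
  in_loc l A b F -> in_loc l A' b' F.
Proof.
move=> A'A bb' /in_locP[AF h]; apply/in_locP; split=> [|C hC CF].
  exact: subset_trans AF.
by apply: leq_trans (h C hC CF) _; apply: leq_sum.
Qed.

(** A cover disjoint from F misses A when A is contained in F. So b may be chosen freely on A,
    whereas the positive part of an actual degree vanishes there. *)
Lemma eq_in_loc l A b b' F : (forall i, i \notin A -> b i = b' i) ->
  in_loc l A b F = in_loc l A b' F.
Proof.
move=> bb'.
have E C : A \subset F -> [disjoint C & F] ->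
    (\sum_(i in C) b i = \sum_(i in C) b' i)%N.
  move=> AF CF; apply: eq_bigr => i iC; apply: bb'.
  apply: contraTN CF => iA; apply/pred0Pn; exists i.
  by rewrite /= iC (subsetP AF).
by apply/in_locP/in_locP => -[AF h]; split=> // C hC CF; have := h C hC CF;
  rewrite E.
Qed.

(** Here A is the only facet containing A, so the degree complex is {∅} as soon as b(~: A) < l, for
    instance for b = 0. *)
Definition facet_degree A := mincover e (~: A).

(* The facets H of the independence complex that contain A are the complements
   of the minimal covers C disjoint from A; those with b(C) < l span the degree
   complex, and (U, ~: U) disconnects it once A is removed from the facets. *)
Definition disconnected_degree l A := exists b U C1 C2 v1 v2,
  [/\ [/\ mincover e C1, [disjoint C1 & A], (\sum_(i in C1) b i < l)%N
        & v1 \notin C1 :|: A /\ v1 \in U],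
      [/\ mincover e C2, [disjoint C2 & A], (\sum_(i in C2) b i < l)%N
        & v2 \notin C2 :|: A /\ v2 \notin U]
    & forall C, mincover e C -> [disjoint C & A] -> (\sum_(i in C) b i < l)%N ->
        (forall v, v \notin C :|: A -> v \in U) \/
        (forall v, v \notin C :|: A -> v \notin U)].

Lemma disconnected_degreeS l A :
  disconnected_degree l A -> disconnected_degree l.+1 A.
Proof.
case=> b [U [C1 [C2 [v1 [v2 []]]]]].
move=> [cC1 C1A bC1 [v1n v1U]] [cC2 C2A bC2 [v2n v2U]] hU.
have C2U v : v \notin C2 :|: A -> v \notin U.
  case: (hU C2) => // h; last exact: h.
  by move: (h v2 v2n); rewrite (negPf v2U).
move: (v1n); rewrite inE negb_or => /andP[v1C1 v1A].
have v1C2 : v1 \in C2.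
  apply: contraTT v1U => v1C2; apply: C2U.
  by rewrite inE negb_or v1C2.
have [w e1w wC2] := mincover_private e_sym e_irr cC2 v1C2.
have wC1 : w \in C1 by have := mincover_edge cC1 e1w; rewrite (negPf v1C1).
pose b' i := (b i + ((i == v1) + (i == w)))%N.
have b'E C :
    (\sum_(i in C) b' i = \sum_(i in C) b i + ((v1 \in C) + (w \in C)))%N.
  have E (x : 'I_n) : (\sum_(i in C) (i == x) = (x \in C))%N.
    rewrite big_mkcond (bigD1 x) //= eqxx big1 ?addn0; first by case: (x \in C).
    by move=> i /negPf ->; case: ifP.
  by rewrite !big_split /= !E.
exists b', U, C1, C2, v1, v2; split; [split=> //|split=> //|].
- by rewrite b'E (negPf v1C1) wC1 add0n addn1.
- by rewrite b'E (negPf wC2) v1C2 addn0 addn1.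
move=> C cC CA; rewrite b'E => hC; apply: hU => //.
have hvw := mincover_edge cC e1w; rewrite -ltnS.
apply: leq_ltn_trans hC; rewrite -addn1 leq_add2l.
by move: hvw; case: (v1 \in C); case: (w \in C).
Qed.

Variables (k : fieldType).
Implicit Types (lam : {set 'I_n} -> k).

(** [lam F] is the coefficient of x^a in the component at F. As in [cocycle], these are lifts to S:
    x^a must lie in S_(x_F), which means that F contains A, and the coboundary must fall into J_l.
    The term [eta] of a coboundary is likewise its part in J_l. *)
Definition graded_cocycle j l A b lam :=
  (forall F, lam F != 0 -> #|F| = j /\ A \subset F) /\
  (forall F, #|F| = j.+1 -> codiff lam F != 0 -> in_loc l A b F).

Definition graded_coboundary j l A b lam := exists beta eta : {set 'I_n} -> k,
  [/\ forall F, beta F != 0 -> #|F|.+1 = j /\ A \subset F,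
      forall F, eta F != 0 -> #|F| = j /\ in_loc l A b F
    & forall F, lam F = codiff beta F + eta F].

Lemma graded_coboundaryS j l A A' b b' lam :
  A' \subset A -> (forall i, b i <= b' i)%N ->
  graded_coboundary j l A b lam -> graded_coboundary j l A' b' lam.
Proof.
move=> A'A bb' [beta [eta [hbeta heta hlam]]]; exists beta, eta; split=> // F.
  by move=> /hbeta[-> AF]; split=> //; exact: subset_trans AF.
by move=> /heta[-> hF]; split=> //; apply: in_locS hF.
Qed.

Lemma graded_cocycleS j l A A' b b' lam :
  A' \subset A -> (forall i, b i <= b' i)%N ->
  graded_cocycle j l A b lam -> graded_cocycle j l A' b' lam.
Proof.
move=> A'A bb' [h1 h2]; split=> F.
  by move=> /h1[-> AF]; split=> //; exact: subset_trans AF.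
by move=> Fj /(h2 F Fj); apply: in_locS.
Qed.

(* A cone: every facet H with b(~: H) < l contains i. *)
Lemma graded_coboundary_cone j l A b lam i : i \notin A -> (l <= b i)%N ->
  graded_cocycle j l A b lam -> graded_coboundary j l A b lam.
Proof.
move=> iA bi [lam_supp lam_cocycle].
(* The contracting homotopy with apex i. Its coboundary agrees with [lam] on the sets containing i;
   elsewhere the difference is, up to sign, the coboundary of [lam] at [i |: F]. *)
pose beta F : k := if i \in F then 0 else (-1) ^+ below i F * lam (i |: F).
have betaE F : i \in F -> codiff beta F = lam F.
  move=> iF; rewrite (codiff_single iF); last first.
    by move=> h hF hi; rewrite /beta !inE eq_sym hi iF.
  rewrite /beta !inE eqxx /= setD1K // mulrA (below_rem i iF) ltnn add0n.
  by rewrite -expr2 sqrr_sign mul1r.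
exists beta, (fun F => lam F - codiff beta F).
split=> F; last by rewrite addrC subrK.
  rewrite /beta; case: ifP => [|/negbT iF]; first by rewrite eqxx.
  rewrite mulf_eq0 negb_or => /andP[_ /lam_supp[]].
  rewrite cardsU1 iF add1n => -> /subsetP AF; split=> //.
  apply/subsetP => a aA; have := AF _ aA; rewrite !inE.
  by case: eqP => // ai; rewrite -ai aA in iA.
have [iF|iF] := boolP (i \in F); first by rewrite betaE // subrr eqxx.
have dE : lam F - codiff beta F = (-1) ^+ below i F * codiff lam (i |: F).
  rewrite [in RHS]/codiff big_setU1 //= setU1K //.
  have iFF : i \in i |: F by rewrite setU11.
  rewrite mulrDr mulrA (below_rem i iFF) ltnn add0n setU1K //.
  rewrite -expr2 sqrr_sign mul1r; congr (_ + _).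
  rewrite /codiff -sumrN mulr_sumr; apply: eq_bigr => h hF.
  have hi : h != i by apply: contraNneq iF => <-.
  rewrite /beta !inE (negPf iF) andbF /=.
  have -> : i |: F :\ h = (i |: F) :\ h.
    by apply/setP => a; rewrite !inE; case: eqP => //= ->; rewrite eq_sym hi.
  rewrite (below_rem i hF) (below_rem h iFF) setU1K // !exprD.
  by move: hi; rewrite neq_ltn => /orP[] hi;
    rewrite hi ltnNge (ltnW hi) /= expr0 expr1; ring.
rewrite dE mulf_eq0 negb_or => /andP[_ d0].
have Fj : #|F| = j.
  apply: contraNeq d0 => Fj; rewrite codiff_eq0 // => h hF.
  apply/eqP; apply: contraNT Fj => /lam_supp[hj _].
  have := cardsU1 i F; rewrite iF add1n (cardsD1 h) hF add1n.
  by rewrite hj => -[->].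
split=> //.
have /in_locP[AiF h] : in_loc l A b (i |: F).
  by apply: lam_cocycle d0; rewrite cardsU1 iF Fj.
 apply/in_locP; split=> [|C hC CF].
  apply/subsetP => a aA; have := subsetP AiF _ aA; rewrite !inE.
  by case: eqP => // ai; rewrite -ai aA in iA.
have [iC|iC] := boolP (i \in C).
  by apply: leq_trans bi _; rewrite (bigD1 i) //= leq_addr.
by apply: h; rewrite // disjoint_setU1 iC.
Qed.

(** Reduced cohomology in degree -1. If [lam A] is nonzero, the coboundary is nonzero at every
    [v |: A]. A minimal cover C disjoint from A is not ~: A, hence misses some v off A, and the
    condition at [v |: A] gives b(C) >= l: so [lam] itself has its values in J_l. *)
Lemma graded_coboundary_top j l A b lam : #|A| = j -> ~ facet_degree A ->
  graded_cocycle j l A b lam -> graded_coboundary j l A b lam.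
Proof.
move=> Aj nfacet [lam_supp lam_cocycle].
exists (fun=> 0), lam; split=> [F|F lamF|F]; first by rewrite eqxx.
  have [Fj AF] := lam_supp F lamF; split=> //.
  have FA : F = A by apply/esym/eqP; rewrite eqEcard AF Fj Aj leqnn.
  rewrite {}FA {AF Fj F} in lamF *.
  apply/in_locP; split=> // C hC CA.
  have [CE|] := boolP (~: A \subset C).
    case: nfacet; rewrite /facet_degree; suff -> : ~: A = C by [].
    by apply/eqP; rewrite eqEsubset CE -disjoints_subset.
  case/subsetPn => v; rewrite inE => vA vC.
  have /in_locP[_] : in_loc l A b (v |: A).
    apply: lam_cocycle; first by rewrite cardsU1 vA Aj.
    rewrite (codiff_single (setU11 v A)).
      by rewrite setU1K // mulf_eq0 signr_eq0.
    move=> h; rewrite in_setU1 => /orP[/eqP ->|hA hv]; first by rewrite eqxx.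
    apply/eqP; apply: contraT => /lam_supp[_ /subsetP/(_ h hA)].
    by rewrite !inE eqxx.
  by apply; rewrite // disjoint_setU1 vC.
by rewrite codiff_eq0 ?add0r.
Qed.

(** Reduced cohomology in degree 0. The sets [v |: A] that are not [in_loc] are the vertices of the
    degree complex; a cocycle is constant on its components, so subtracting a constant leaves a
    cochain vanishing at all vertices, unless the complex is disconnected. *)
Lemma graded_coboundary_codim1 j l A b lam : #|A|.+1 = j ->
  ~ disconnected_degree l A ->
  graded_cocycle j l A b lam -> graded_coboundary j l A b lam.
Proof.
move=> Aj conn [lam_supp lam_cocycle].
have [/existsP[v0 /andP[v0A Fv0]]|/existsPn loc] :=
    boolP [exists v, (v \notin A) && ~~ in_loc l A b (v |: A)]; last first.
  exists (fun=> 0), lam; split=> [F|F lamF|F]; first by rewrite eqxx.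
    have [Fj AF] := lam_supp F lamF; split=> //.
    have [v vA ->] : exists2 v, v \notin A & F = v |: A.
      by apply: card_succ_sub => //; rewrite Fj.
    by have := loc v; rewrite vA /= negbK.
  by rewrite codiff_eq0 ?add0r.
pose chi F : k := (F == A)%:R.
(* The constant, with the sign of the cochain convention, that makes [mu] vanish at the vertex
   v0. *)
pose kappa := (-1) ^+ below v0 (v0 |: A) * lam (v0 |: A).
pose mu F := lam F - kappa * codiff chi F.
have codiff_chi v :
    v \notin A -> codiff chi (v |: A) = (-1) ^+ below v (v |: A).
  move=> vA; rewrite (codiff_single (setU11 v A)) => [|h hF hv].
    by rewrite /chi setU1K // eqxx mulr1.
  rewrite /chi; case: eqP => // hA; have /setP/(_ h) := hA.
  by move: hF; rewrite !inE eqxx (negPf hv) /= => ->.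
have mu_supp F : mu F != 0 -> exists2 v, v \notin A & F = v |: A.
  move=> muF; have [lam0|/lam_supp[Fj AF]] := eqVneq (lam F) 0; last first.
    by apply: card_succ_sub => //; rewrite Fj.
  have [/existsP[i /andP[iF /eqP iA]]|/existsPn h] :=
    boolP [exists i, (i \in F) && (F :\ i == A)].
    by exists i; rewrite -iA ?setD1K // !inE eqxx.
  case/eqP: muF; rewrite /mu lam0 codiff_eq0 ?mulr0 ?subr0 // => i iF.
  by have := h i; rewrite iF /chi /= => /negPf ->.
have mu_v0 : mu (v0 |: A) = 0.
  by rewrite /mu codiff_chi // mulrAC -expr2 sqrr_sign mul1r subrr.
have codiff_mu F : codiff mu F = codiff lam F.
  by rewrite codiffB codiffZ codiff_codiff mulr0 subr0.
exists (fun F => kappa * chi F), mu; split=> [F|F muF|F].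
- rewrite /chi; case: (eqVneq F A) => [-> _|_]; first by split.
  by rewrite mulr0 eqxx.
- have [v vA FE] := mu_supp F muF; rewrite {}FE {F} in muF *.
  rewrite cardsU1 vA add1n Aj; split=> //; apply: contraT => Fv; case: conn.
  have witness w : w \notin A -> ~~ in_loc l A b (w |: A) -> exists C,
      [/\ mincover e C, [disjoint C & A], (\sum_(i in C) b i < l)%N
        & w \notin C :|: A].
    move=> wA; rewrite /in_loc subsetUr /= => /forallPn[C].
    rewrite negb_imply disjoint_setU1 -ltnNge => /andP[/and3P[cC wC CA] bC].
    by exists C; split; rewrite // inE negb_or wC.
  have [C0 [cC0 C0A bC0 v0C0]] := witness v0 v0A Fv0.
  have [C1 [cC1 C1A bC1 vC1]] := witness v vA Fv.
  (* A facet meeting both U and its complement would contain an edge on which the coboundary of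
     [mu], which is that of [lam], is nonzero. *)
  pose U := [set w | mu (w |: A) == 0].
  exists b, U, C0, C1, v0, v; split; [split=> //|split=> //|].
  - by split=> //; rewrite inE mu_v0.
  - by split=> //; rewrite inE.
  move=> C cC CA bC; apply: contrapT => /not_orP[].
  move=> /existsNP[w /not_implyP[wC /negP wU]].
  move=> /existsNP[u /not_implyP[uC /negP]]; rewrite negbK => uU.
  move: wC uC wU uU; rewrite !inE !negb_or => /andP[wC wA] /andP[uC uA] muw muu.
  have uw : u != w by apply: contraNneq muw => <-.
  have uwA : u \notin w |: A by rewrite !inE negb_or uw.
  have : codiff mu (u |: (w |: A)) != 0.
    rewrite (codiff_single (setU11 _ _)) => [|h hF hu].
      by rewrite setU1K // mulf_eq0 signr_eq0.
    have [->|hw] := eqVneq h w.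
      by rewrite setUCA setU1K ?(eqP muu) // !inE negb_or eq_sym uw.
    apply/eqP; apply: contraT => /mu_supp[a aA /setP/(_ h)].
    by move: hF; rewrite !inE eqxx (negPf hu) (negPf hw) /= => ->; rewrite orbT.
  rewrite codiff_mu => /lam_cocycle/in_locP[].
    by rewrite !cardsU1 uwA wA !add1n Aj.
  by move=> _ /(_ C cC); rewrite !disjoint_setU1 uC wC CA leqNgt bC => /(_ isT).
- by rewrite codiffZ /mu addrC subrK.
Qed.

Lemma graded_coboundary_exact j l A b lam :
  (forall B, #|B| = j -> ~ facet_degree B) ->
  (forall B, #|B|.+1 = j -> ~ disconnected_degree l B) ->
  (j <= #|A|.+1)%N ->
  graded_cocycle j l A b lam -> graded_coboundary j l A b lam.
Proof.
move=> nfacet conn; rewrite leq_eqVlt => /orP[/eqP jA|].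
  by apply: graded_coboundary_codim1; [|exact: conn].
rewrite ltnS leq_eqVlt => /orP[/eqP jA|jA].
  by apply: graded_coboundary_top; [|exact: nfacet].
case=> lam_supp _; have lam0 F : lam F = 0.
  apply/eqP; apply: contraTT jA => /lam_supp[<- AF].
  by rewrite -leqNgt subset_leq_card.
exists (fun=> 0), (fun=> 0); split=> F; rewrite ?eqxx //.
by rewrite codiff_eq0 ?addr0.
Qed.

End Degrees.

(** * Laurent polynomials and local cohomology *)

Section Laurent.
Variables (k : fieldType) (n : nat).
Notation S := {mpoly k[n]}.
Notation mon := 'X_{1..n}.
Implicit Types (F : {set 'I_n}) (g : S) (u m : mon) (T t : nat).

Definition mnm_ind F : mon := [multinom (i \in F : nat) | i < n].
Definition mnm_cst T : mon := [multinom T | i < n].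

Lemma mnm_cstD T t : mnm_cst (T + t) = (mnm_cst T + mnm_cst t)%MM.
Proof. by apply/mnmP => i; rewrite mnmDE !mnmE. Qed.

Lemma mnm_ind_cst F t : (mnm_ind F *+ t + mnm_ind (~: F) *+ t)%MM = mnm_cst t.
Proof.
by apply/mnmP => i; rewrite mnmDE !mulmnE !mnmE inE; case: (i \in F);
  rewrite /= ?mul1n ?mul0n ?addn0.
Qed.

Lemma xprodX F t : xprod k F ^+ t = 'X_[mnm_ind F *+ t].
Proof.
rewrite -mpolyXn; congr (_ ^+ _); rewrite /xprod mpolyXE_id.
rewrite big_mkcond; apply: eq_bigr => i _.
by rewrite mnmE; case: (i \in F).
Qed.

Lemma mpolyX_neq0 m : 'X_[m] != 0 :> S.
Proof. by rewrite -msize_poly_eq0 msizeX. Qed.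

Lemma fracX_neq0 m : 'X_[m]%:F != 0 :> {fraction S}.
Proof. by rewrite tofrac_eq0 mpolyX_neq0. Qed.

(* The Laurent polynomial g / (x_1 ... x_n)^T; its terms of exponent a in Z^n
   come from the terms of g of exponent a + T. *)
Definition laurent g T : {fraction S} := g%:F / 'X_[mnm_cst T]%:F.

Definition is_laurent (f : {fraction S}) := exists g T, f = laurent g T.

Lemma frac_eq (g g' : S) m m' :
  (g%:F / 'X_[m]%:F = g'%:F / 'X_[m']%:F :> {fraction S}) <->
  g * 'X_[m'] = g' * 'X_[m].
Proof.
split=> [/eqP|h].
  by rewrite eqr_div ?fracX_neq0 // -!tofracM tofrac_eq => /eqP.
by apply/eqP; rewrite eqr_div ?fracX_neq0 // -!tofracM h.
Qed.

Lemma laurent_xprod g F t : g%:F / (xprod k F)%:F ^+ t =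
  laurent (g * 'X_[mnm_ind (~: F) *+ t]) t.
Proof.
rewrite -tofracXn xprodX; apply/frac_eq.
by rewrite -mulrA -mpolyXD addmC mnm_ind_cst.
Qed.

Lemma laurent_shift g T t : laurent g T = laurent (g * 'X_[mnm_cst t]) (T + t).
Proof. by apply/frac_eq; rewrite -mulrA -mpolyXD mnm_cstD addmC. Qed.

Lemma laurentD g g' T : laurent (g + g') T = laurent g T + laurent g' T.
Proof. by rewrite /laurent tofracD mulrDl. Qed.

Lemma laurentM (s : S) g T : laurent (s * g) T = s%:F * laurent g T.
Proof. by rewrite /laurent tofracM mulrA. Qed.

Lemma is_laurent2 f f' : is_laurent f -> is_laurent f' ->
  exists g g' T, f = laurent g T /\ f' = laurent g' T.
Proof.
case=> g [T ->] [g' [T' ->]]; rewrite (laurent_shift g T T').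
rewrite (laurent_shift g' T' T) [(T' + T)%N]addnC.
by do 3!eexists.
Qed.

Lemma is_laurent0 : is_laurent 0.
Proof. by exists 0, 0%N; rewrite /laurent tofrac0 mul0r. Qed.

Lemma is_laurentD f f' : is_laurent f -> is_laurent f' -> is_laurent (f + f').
Proof.
move=> hf hf'; have [g [g' [T [-> ->]]]] := is_laurent2 hf hf'.
by exists (g + g'), T; rewrite laurentD.
Qed.

Lemma is_laurentM (s : S) f : is_laurent f -> is_laurent (s%:F * f).
Proof. by case=> g [T ->]; exists (s * g), T; rewrite laurentM. Qed.

Lemma is_laurent_sum (I : Type) (r : seq I) (P : pred I)
    (f : I -> {fraction S}) :
  (forall i, P i -> is_laurent (f i)) -> is_laurent (\sum_(i <- r | P i) f i).
Proof.
by move=> h; elim/big_ind: _ => //; [exact: is_laurent0 | exact: is_laurentD].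
Qed.

(* The coefficient of f at the exponent u - T (junk value 0 off the Laurent
   polynomials). *)
Definition lcoeff u T (f : {fraction S}) : k :=
  if pselect (exists p : S * nat, f = laurent p.1 p.2) is left h then
    ((sval (cid h)).1 * 'X_[mnm_cst T])@_(u + mnm_cst (sval (cid h)).2)
  else 0.

(** Cross-multiplication shows that the coefficient does not depend on the representative selected
    by choice. *)
Lemma lcoeffE u T g t :
  lcoeff u T (laurent g t) = (g * 'X_[mnm_cst T])@_(u + mnm_cst t).
Proof.
rewrite /lcoeff; case: pselect => [h|[]]; last by exists (g, t).
case: (cid h) => [[g' t'] /= /frac_eq E].
rewrite -(mcoeffMX _ (mnm_cst t)) -[RHS](mcoeffMX _ (mnm_cst t')).
rewrite mulrAC -E mulrAC; congr (_@_ _).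
by apply/mnmP => i; rewrite !mnmDE; lia.
Qed.

Lemma lcoeff_same u T g : lcoeff u T (laurent g T) = g@_u.
Proof. by rewrite lcoeffE addmC mcoeffMX. Qed.

Lemma lcoeffD u T f f' : is_laurent f -> is_laurent f' ->
  lcoeff u T (f + f') = lcoeff u T f + lcoeff u T f'.
Proof.
move=> hf hf'; have [g [g' [t [-> ->]]]] := is_laurent2 hf hf'.
by rewrite -laurentD !lcoeffE mulrDl mcoeffD.
Qed.

Lemma lcoeff0 u T : lcoeff u T 0 = 0.
Proof.
have -> : 0 = laurent 0 0 by rewrite /laurent tofrac0 mul0r.
by rewrite lcoeffE mul0r mcoeff0.
Qed.

Lemma lcoeffZ u T (a : k) f : is_laurent f ->
  lcoeff u T (a%:MP%:F * f) = a * lcoeff u T f.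
Proof.
by case=> g [t ->]; rewrite -laurentM !lcoeffE -mulrA mcoeffCM.
Qed.

Lemma lcoeff_sum u T (I : Type) (r : seq I) (P : pred I)
    (f : I -> {fraction S}) :
  (forall i, P i -> is_laurent (f i)) ->
  lcoeff u T (\sum_(i <- r | P i) f i) = \sum_(i <- r | P i) lcoeff u T (f i).
Proof.
move=> h; elim: r => [|i r IHr]; first by rewrite !big_nil lcoeff0.
rewrite !big_cons; case: ifP => // Pi; rewrite lcoeffD ?IHr //; first exact: h.
exact: is_laurent_sum.
Qed.

Lemma loc_ideal_laurent (J : {pred S}) F f : loc_ideal J F f -> is_laurent f.
Proof. by case=> g _ [t ->]; rewrite laurent_xprod; do 2!eexists. Qed.

Lemma signF a : (-1) ^+ a = ((-1) ^+ a : k)%:MP%:F :> {fraction S}.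
Proof. by rewrite rmorphXn rmorphN1 tofracXn tofracN tofrac1. Qed.

(** Makes a form that reads the coefficients at one exponent vanish in all but one degree, as the
    graded dual requires. *)
Lemma lcoeff_neq0_homog u T F d f : loc_homog F d f -> lcoeff u T f != 0 ->
  d = (mdeg u)%:Z - (n * T)%N%:Z.
Proof.
case=> [->|[g [m [t [/dhomogP hg -> ->]]]]]; first by rewrite lcoeff0 eqxx.
rewrite laurent_xprod lcoeffE -mulrA -mpolyXD -mcoeff_msupp.
rewrite (perm_mem (msuppMX _ _)) => /mapP[m' /hg /= m'm /(congr1 mdeg)].
rewrite !mdegD !mdegMn m'm.
have mdeg_ind G : mdeg (mnm_ind G) = #|G|.
  rewrite mdegE -sum1_card big_mkcond [RHS]big_mkcond; apply: eq_bigr => i _.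
  by rewrite mnmE; case: (i \in G).
have mdeg_cst a : mdeg (mnm_cst a) = (n * a)%N.
  rewrite mdegE; under eq_bigr do rewrite mnmE.
  by rewrite sum_nat_const card_ord.
rewrite mdeg_ind !mdeg_cst; have := congr1 (muln^~ t) (cardsC F).
rewrite card_ord /= mulnDl => hF hm; rewrite [(t * _)%N]mulnC; lia.
Qed.

Variables (e : rel 'I_n) (l : nat) (J : {pred S}).
Hypothesis JE : J =i mon_ideal (sym_mon e l).

Definition neg_part u T := [set i | (u i < T)%N].
Definition pos_part u T i := (u i - T)%N.

Lemma lcoeff_loc_ideal u T F f : loc_ideal J F f -> lcoeff u T f != 0 ->
  in_loc e l (neg_part u T) (pos_part u T) F.
Proof.
case=> g; rewrite JE => /allP hg [t ->].
rewrite laurent_xprod lcoeffE -mulrA -mpolyXD -mcoeff_msupp.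
rewrite (perm_mem (msuppMX _ _)) => /mapP[m' /hg /sym_monP m'l /mnmP h].
have E i : (u i + t * (i \in F) = m' i + T)%N.
  move: (h i); rewrite !mnmDE mulmnE !mnmE inE; case: (i \in F) => /=; lia.
apply/in_locP; split=> [|C cC CF].
  apply/subsetP => i; rewrite inE; have := E i; case: (i \in F) => //; lia.
apply: leq_trans (m'l C cC) _; apply: leq_sum => i iC; rewrite /pos_part.
have := E i; rewrite (disjointFr CF iC); lia.
Qed.

Lemma loc_ideal_mono u T F : in_loc e l (neg_part u T) (pos_part u T) F ->
  loc_ideal J F (laurent 'X_[u] T).
Proof.
case/in_locP => /subsetP uF h.
(* Multiplying by x_F^(T + l) clears the negative exponents, which all lie in F, and leaves
   exponents at least l on F, so that every cover meeting F has degree at least l. *)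
pose m' : mon := [multinom (u i + (T + l) * (i \in F) - T)%N | i < n].
have E : (u + mnm_ind F *+ (T + l) = m' + mnm_cst T)%MM.
  apply/mnmP => i; rewrite !mnmDE mulmnE !mnmE; have := uF i; rewrite inE.
  by case: (i \in F) => [_|/implyP]; [lia|rewrite implybF -leqNgt; lia].
exists 'X_[m'].
  rewrite JE mon_idealX; apply/sym_monP => C cC.
  have [CF|/pred0Pn[i /andP[/= iC iF]]] := boolP [disjoint C & F].
    apply: leq_trans (h C cC CF) _; apply: leq_sum => i iC.
    by rewrite mnmE (disjointFr CF iC) /pos_part muln0 addn0.
  by apply: leq_trans (leq_mdegin _ iC); rewrite mnmE iF; lia.
exists (T + l)%N; rewrite -tofracXn xprodX; apply/frac_eq.
by rewrite -!mpolyXD E.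
Qed.

Lemma loc_ideal0 F : loc_ideal J F 0.
Proof.
exists 0; first by rewrite JE mon_ideal0.
by exists 0%N; rewrite tofrac0 mul0r.
Qed.

Lemma loc_idealD F f f' : loc_ideal J F f -> loc_ideal J F f' ->
  loc_ideal J F (f + f').
Proof.
case=> g Jg [t ->] [g' Jg' [t' ->]].
have X0 : (xprod k F)%:F != 0 :> {fraction S}.
  by rewrite -[xprod k F]expr1 xprodX fracX_neq0.
exists (xprod k F ^+ t' * g + xprod k F ^+ t * g').
  rewrite JE; apply: mon_idealD; apply: mon_idealMl; rewrite -?JE //;
    exact: upclosed_sym_mon.
exists (t + t')%N.
rewrite addf_div ?expf_neq0 // tofracD !tofracM !tofracXn exprD.
by congr (_ / _); rewrite mulrC [X in _ + X]mulrC.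
Qed.

Lemma loc_idealMl F (s : S) f : loc_ideal J F f -> loc_ideal J F (s%:F * f).
Proof.
case=> g Jg [t ->]; exists (s * g).
  by rewrite JE; apply: mon_idealMl; rewrite -?JE //; exact: upclosed_sym_mon.
by exists t; rewrite tofracM mulrA.
Qed.

End Laurent.

(** * Cech cochains concentrated in one multidegree *)

Section Cochains.
Variables (k : fieldType) (n : nat).
Notation S := {mpoly k[n]}.
Notation mon := 'X_{1..n}.
Implicit Types (F : {set 'I_n}) (u m : mon) (T : nat) (c : cochain k n).
Implicit Types (lam : {set 'I_n} -> k).

Variables (e : rel 'I_n) (l : nat) (J : {pred S}).
Hypothesis JE : J =i mon_ideal (sym_mon e l).

(** The case l = 0: the lemmas about J then also apply to the Cech complex of S. *)
Lemma predT_mon_ideal : (predT : {pred S}) =i mon_ideal (sym_mon e 0).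
Proof. by move=> p; apply/esym/mon_idealP => m _; apply/sym_monP. Qed.

Lemma in_loc0 (A : {set 'I_n}) b F : in_loc e 0 A b F = (A \subset F).
Proof. by apply/in_locP/idP => [[]|]. Qed.

Definition mono_cochain u T lam : cochain k n :=
  [ffun F => (lam F)%:MP%:F * laurent 'X_[u] T].

Lemma cech_diff_mono u T lam :
  cech_diff (mono_cochain u T lam) = mono_cochain u T (codiff lam).
Proof.
apply/ffunP => F; rewrite !ffunE /codiff rmorph_sum rmorph_sum mulr_suml.
apply: eq_bigr => i _; rewrite ffunE mulrA signF.
by rewrite -tofracM -mpolyCM.
Qed.

Lemma mono_cochainD u T lam lam' :
  mono_cochain u T lam + mono_cochain u T lam' =
  mono_cochain u T (fun F => lam F + lam' F).
Proof. by apply/ffunP => F; rewrite !ffunE mpolyCD tofracD mulrDl. Qed.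

Lemma cech_mono (j : nat) u T lam :
  (forall F, lam F != 0 ->
     #|F| = j /\ in_loc e l (neg_part u T) (pos_part u T) F) ->
  cech J j%:Z (mono_cochain u T lam).
Proof.
move=> h F; rewrite ffunE eqz_nat.
have [lam0|/h[Fj Floc]] := eqVneq (lam F) 0.
  rewrite lam0 mpolyC0 tofrac0 mul0r; case: ifP => // _; exact: loc_ideal0 JE _.
by rewrite Fj eqxx; apply: (loc_idealMl JE); exact: (loc_ideal_mono JE).
Qed.

Lemma cech_lcoeff (a : int) c u T F : cech J a c -> lcoeff u T (c F) != 0 ->
  #|F|%:Z = a /\ in_loc e l (neg_part u T) (pos_part u T) F.
Proof.
move=> /(_ F); case: eqP => [-> hF c0|_ ->]; last by rewrite lcoeff0 eqxx.
by split=> //; exact: (lcoeff_loc_ideal JE hF).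
Qed.

Lemma cechD (a : int) c c' : cech J a c -> cech J a c' -> cech J a (c + c').
Proof.
move=> hc hc' F; move: (hc F) (hc' F); rewrite ffunE; case: ifP => _.
  exact: (loc_idealD JE).
by move=> -> ->; rewrite addr0.
Qed.

End Cochains.

(** * Decomposition of Cech cochains into multidegrees, and the upper bound for dim K^j *)

Section Cocycles.
Variables (k : fieldType) (n : nat).
Notation S := {mpoly k[n]}.
Notation mon := 'X_{1..n}.
Implicit Types (F : {set 'I_n}) (u m : mon) (T : nat) (c : cochain k n).
Implicit Types (lam : {set 'I_n} -> k) (j : nat).

Variables (e : rel 'I_n) (l : nat) (J : {pred S}).
Hypothesis JE : J =i mon_ideal (sym_mon e l).

Lemma cech_monoT j u T lam :
  (forall F, lam F != 0 -> #|F| = j /\ neg_part u T \subset F) ->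
  cech predT j%:Z (mono_cochain u T lam).
Proof.
move=> h; apply: (cech_mono (@predT_mon_ideal _ _ e)) => F.
by rewrite in_loc0; exact: h.
Qed.

Lemma cechT_lcoeff (a : int) c u T F :
  cech predT a c -> lcoeff u T (c F) != 0 ->
  #|F|%:Z = a /\ neg_part u T \subset F.
Proof.
by move=> h /(cech_lcoeff (@predT_mon_ideal _ _ e) h); rewrite in_loc0.
Qed.

Lemma cech_laurent (P : {pred S}) (a : int) c F :
  cech P a c -> is_laurent (c F).
Proof.
move=> /(_ F); case: ifP => _ => [|->]; last exact: is_laurent0.
exact: loc_ideal_laurent.
Qed.

Lemma lcoeff_cech_diff c u T F : (forall G, is_laurent (c G)) ->
  lcoeff u T (cech_diff c F) = codiff (fun G => lcoeff u T (c G)) F.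
Proof.
move=> hc; rewrite ffunE lcoeff_sum => [|i _]; last first.
  by rewrite signF; exact: is_laurentM.
by apply: eq_bigr => i _; rewrite signF lcoeffZ.
Qed.

Lemma cocycle_lcoeff j c u T : cocycle J j%:Z c ->
  graded_cocycle e j l (neg_part u T) (pos_part u T)
    (fun F => lcoeff u T (c F)).
Proof.
case=> hc hdc; split=> F.
  by move=> /(cechT_lcoeff hc)[/eqP]; rewrite eqz_nat => /eqP.
move=> _; rewrite -lcoeff_cech_diff; last by move=> G; exact: cech_laurent hc.
by move=> /(cech_lcoeff JE hdc)[].
Qed.

Lemma coboundary_lcoeff j c u T : coboundary J j%:Z c ->
  graded_coboundary e j l (neg_part u T) (pos_part u T)
    (fun F => lcoeff u T (c F)).
Proof.
case=> b [d [hb hd ->]].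
exists (fun F => lcoeff u T (b F)), (fun F => lcoeff u T (d F)); split=> F.
- by move=> /(cechT_lcoeff hb)[hF uF]; split=> //; lia.
- by move=> /(cech_lcoeff JE hd)[hF uF]; split=> //; lia.
have lau_b G : is_laurent (b G) by exact: cech_laurent hb.
rewrite [X in lcoeff _ _ X]ffunE lcoeffD; last exact: cech_laurent hd.
  by rewrite lcoeff_cech_diff.
rewrite ffunE; apply: is_laurent_sum => i _; rewrite signF; exact: is_laurentM.
Qed.

Lemma cocycle_mono j u T lam :
  graded_cocycle e j l (neg_part u T) (pos_part u T) lam ->
  cocycle J j%:Z (mono_cochain u T lam).
Proof.
case=> lam_supp lam_cocycle; split; first exact: cech_monoT.
rewrite cech_diff_mono -PoszD addn1; apply: (cech_mono JE) => F dF.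
suff Fj : #|F| = j.+1 by split=> //; exact: lam_cocycle.
apply: contraNeq dF => Fj; rewrite codiff_eq0 // => i iF.
apply/eqP; apply: contraNT Fj => /lam_supp[<- _].
by rewrite (cardsD1 i) iF.
Qed.

Lemma coboundary_mono j u T lam :
  graded_coboundary e j l (neg_part u T) (pos_part u T) lam ->
  coboundary J j%:Z (mono_cochain u T lam).
Proof.
case=> beta [eta [hbeta heta hlam]].
exists (mono_cochain u T beta), (mono_cochain u T eta); split.
(* For j = 0 the cochain [beta] sits in degree -1, where it must vanish since no set has that
   cardinality. *)
- have := @cech_monoT j.-1 u T beta; case: j hbeta {heta} => [|j] hbeta.
    move=> _ F; rewrite ffunE; case: eqP => [|_]; first lia.
    have [->|/hbeta[]//] := eqVneq (beta F) 0.
    by rewrite mpolyC0 tofrac0 mul0r.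
  have -> : j.+1%:Z - 1 = j%:Z by lia.
  by apply=> F /hbeta[[->] ?].
- exact: (cech_mono JE).
- rewrite cech_diff_mono mono_cochainD; apply/ffunP => F.
  by rewrite !ffunE hlam.
Qed.

Lemma coboundary0 (a : int) : coboundary J a 0.
Proof.
exists 0, 0; split.
- by move=> F; rewrite ffunE; case: ifP => // _; exists 0 => //; exists 0%N;
    rewrite tofrac0 mul0r.
- by move=> F; rewrite ffunE; case: ifP => // _; exact: loc_ideal0 JE _.
- rewrite addr0; apply/ffunP => F; rewrite !ffunE big1 // => i _.
  by rewrite ffunE mulr0.
Qed.

Lemma cech_diffD c c' : cech_diff (c + c') = cech_diff c + cech_diff c'.
Proof.
apply/ffunP => F; rewrite !ffunE -big_split; apply: eq_bigr => i _.
by rewrite ffunE mulrDr.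
Qed.

Lemma coboundaryD (a : int) c c' :
  coboundary J a c -> coboundary J a c' -> coboundary J a (c + c').
Proof.
case=> b [d [hb hd ->]] [b' [d' [hb' hd' ->]]].
exists (b + b'), (d + d'); split.
- exact: (cechD (@predT_mon_ideal _ _ e)).
- exact: (cechD JE).
- by rewrite cech_diffD addrACA.
Qed.

Lemma coboundary_sum (a : int) (I : Type) (r : seq I) (P : pred I)
    (f : I -> cochain k n) :
  (forall i, P i -> coboundary J a (f i)) ->
  coboundary J a (\sum_(i <- r | P i) f i).
Proof.
move=> h; elim/big_ind: _ => //; [exact: coboundary0 | exact: coboundaryD].
Qed.

(** A common denominator (x_1 ... x_n)^T exists for the finitely many components; the numerators are
    then split into monomials. *)
Lemma cochain_expand c : (forall F, is_laurent (c F)) -> exists T K,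
  c = \sum_(m : 'X_{1..n < K}) mono_cochain m T (fun F => lcoeff m T (c F)).
Proof.
move=> hc; have /fin_all_exists[gT hgT] : forall F, exists gT : S * nat,
    c F = laurent gT.1 gT.2 by move=> F; have [g [T ->]] := hc F; exists (g, T).
pose T := (\max_F (gT F).2)%N.
pose g F := (gT F).1 * 'X_[mnm_cst n (T - (gT F).2)].
have cE F : c F = laurent (g F) T.
  by rewrite hgT (laurent_shift _ _ (T - (gT F).2)) subnKC // leq_bigmax.
exists T, (\max_F msize (g F))%N; apply/ffunP => F; rewrite sum_ffunE.
rewrite {1}cE /laurent.
rewrite (mpolywE (k := (\max_F msize (g F))%N) (p := g F)) ?leq_bigmax //.
rewrite rmorph_sum mulr_suml; apply: eq_bigr => m _.
by rewrite ffunE -laurentM cE lcoeff_same mul_mpolyC.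
Qed.

Lemma cscale_sum (s : S) (I : Type) (r : seq I) (P : pred I)
    (f : I -> cochain k n) :
  cscale s (\sum_(i <- r | P i) f i) = \sum_(i <- r | P i) cscale s (f i).
Proof.
apply/ffunP => F; rewrite ffunE !sum_ffunE mulr_sumr.
by apply: eq_bigr => i _; rewrite ffunE.
Qed.

Lemma cscale_mono m u T lam :
  cscale 'X_[m] (mono_cochain u T lam) = mono_cochain (u + m) T lam.
Proof.
apply/ffunP => F; rewrite !ffunE mulrCA.
by rewrite mpolyXD [_ * 'X_[m]]mulrC laurentM.
Qed.

(* In a degree whose negative support contains B the cohomology vanishes; in the
   other ones, multiplication by x_B ^ l leads to a degree where some coordinate
   is at least l, and the complex is a cone. *)
Lemma xprod_ann_canonical_dual j (B : {set 'I_n}) :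
  (forall A : {set 'I_n}, #|A| = j -> ~ facet_degree e A) ->
  (forall A : {set 'I_n}, #|A|.+1 = j -> ~ disconnected_degree e l A) ->
  (j <= #|B|.+1)%N ->
  xprod k B ^+ l \in ann_canonical_dual J j%:Z.
Proof.
move=> nfacet conn jB; apply/asboolP => phi [_ phi0 _] c hc; apply: phi0.
have [T [K ->]] := cochain_expand (fun F => cech_laurent F hc.1).
rewrite xprodX cscale_sum; apply: coboundary_sum => m _.
rewrite cscale_mono; apply: coboundary_mono.
set lam := (fun F => _).
have lam_cocycle : graded_cocycle e j l (neg_part m T) (pos_part m T) lam.
  exact: cocycle_lcoeff.
have negS : neg_part (m + mnm_ind B *+ l) T \subset neg_part m T.
  by apply/subsetP => i; rewrite !inE mnmDE; lia.
have posS i : (pos_part m T i <= pos_part (m + mnm_ind B *+ l) T i)%N.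
  by rewrite /pos_part mnmDE; lia.
have [Bneg|/subsetPn[i iB]] := boolP (B \subset neg_part m T).
  apply: (graded_coboundaryS negS posS); apply: graded_coboundary_exact => //.
  by apply: leq_trans jB _; rewrite ltnS subset_leq_card.
rewrite inE -leqNgt => Ti.
apply: (graded_coboundary_cone (i := i)).
- by rewrite inE mnmDE; lia.
- by rewrite /pos_part mnmDE mulmnE mnmE iB; lia.
- exact: (graded_cocycleS negS posS).
Qed.

Theorem krull_dim_ge_data j :
  krull_dim_ge (ann_canonical_dual J j%:Z) (j%:Z - 2 + 1) ->
  (exists2 A : {set 'I_n}, #|A| = j & facet_degree e A) \/
  (exists2 A : {set 'I_n}, #|A|.+1 = j & disconnected_degree e l A).
Proof.
case=> d [p [jd p_prime p_chain]]; apply: contrapT => /not_orP[nfacet conn].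
(* If |W| >= j - 1, a power of the product of the variables of W annihilates K^j and lies in p 0,
   and so does one of these variables. Hence |W| <= j - 2, too small for the given chain. *)
pose W := [set i | 'X_i \notin p 0%N].
have [p0_prime ann_p0] := p_prime 0%N isT.
have WJ : (#|W|.+1 < j)%N.
  rewrite ltnNge; apply/negP => jW.
  have : xprod k W ^+ l \in p 0%N.
    apply: ann_p0; apply: xprod_ann_canonical_dual => // A Aj hA.
      by apply: nfacet; exists A.
    by apply: conn; exists A.
  move/(prime_idealX p0_prime)/(prime_ideal_prod p0_prime) => [i].
  by rewrite inE => /negP.
suff : (d <= #|W|)%N by lia.
apply: (krull_dim_bound (p := p)) => [i /p_prime[] //|//|i].
by rewrite inE negbK.
Qed.

End Cocycles.

(** * The dimension of the canonical duals *)

Section Detection.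
Variables (n : nat) (e : rel 'I_n) (k : fieldType).
Implicit Types (A B C F U : {set 'I_n}) (b : 'I_n -> nat).

(** Nonvanishing cohomology in the degree (A, b), witnessed by a linear form [alpha] that kills
    coboundaries; an element of K^j is built from it. *)
Definition detected j l A b := exists lam alpha : {set 'I_n} -> k,
  [/\ graded_cocycle e j l A b lam,
      forall mu, graded_coboundary e j l A b mu -> \sum_F alpha F * mu F = 0
    & \sum_F alpha F * lam F != 0].

Lemma sum_delta F (a : k) (mu : {set 'I_n} -> k) :
  \sum_G a * (G == F)%:R * mu G = a * mu F.
Proof.
rewrite (bigD1 F) //= eqxx mulr1 big1 ?addr0 // => G /negPf ->.
by rewrite mulr0 mul0r.
Qed.

Lemma facet_detected l A : (0 < l)%N -> facet_degree e A ->
  detected #|A| l A (fun=> 0%N).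
Proof.
move=> l0 cA; pose chi F : k := (F == A)%:R.
(* The only minimal cover disjoint from A is ~: A, and it meets every larger set: hence [chi] is a
   cocycle. No coboundary has a nonzero value at A, because b(~: A) = 0 < l. *)
exists chi, (fun F => 1 * (F == A)%:R); split.
- split=> F; first by rewrite /chi; case: (eqVneq F A) => [->|]; rewrite ?eqxx.
  move=> _ dF; apply/in_locP.
  have [i iF FA] : exists2 i, i \in F & F :\ i = A.
    apply: contrapT => /forall2NP h; case/eqP: dF; apply: codiff_eq0 => i iF.
    by rewrite /chi; case: (eqVneq (F :\ i) A) => // FA; case: (h i).
  split=> [|C cC CF]; first by rewrite -FA subD1set.
  have CA : C = ~: A.
    apply: (minsetinf cA); first by case/minsetP: cC.
    rewrite -disjoints_subset -FA; apply: disjointWr CF; exact: subD1set.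
  by move: (disjointFl CF iF); rewrite CA -FA !inE eqxx.
- move=> mu [beta [eta [hbeta heta hmu]]]; rewrite sum_delta mul1r hmu.
  rewrite codiff_eq0 ?add0r => [|i iA].
    apply/eqP; apply: contraT => /heta[_ /in_locP[_ /(_ _ cA)]].
    rewrite disjoints_subset subxx => /(_ isT).
    by rewrite big1 // leqNgt l0.
  apply/eqP; apply: contraT => /hbeta[_ /subsetP/(_ i iA)].
  by rewrite !inE eqxx.
- by rewrite sum_delta /chi eqxx mul1r oner_neq0.
Qed.

Lemma disconnected_detected l A : disconnected_degree e l A ->
  exists b, detected #|A|.+1 l A b.
Proof.
case=> b [U [C1 [C2 [v1 [v2 []]]]]].
move=> [cC1 C1A bC1 [v1n v1U]] [cC2 C2A bC2 [v2n v2U]] hU; exists b.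
move: v1n v2n; rewrite !inE !negb_or => /andP[v1C1 v1A] /andP[v2C2 v2A].
pose chi F : k := (F == A)%:R.
(* Up to sign, the indicator of U on the vertices [v |: A]; [alpha] compares its values at v1 and
   v2, which are equal for a coboundary. *)
pose lam F : k :=
  \sum_(v in F) (-1) ^+ below v F * ((v \in U)%:R * chi (F :\ v)).
pose alpha F : k := (-1) ^+ below v1 (v1 |: A) * (F == v1 |: A)%:R -
                    (-1) ^+ below v2 (v2 |: A) * (F == v2 |: A)%:R.
have alphaE mu : \sum_F alpha F * mu F =
    (-1) ^+ below v1 (v1 |: A) * mu (v1 |: A) -
    (-1) ^+ below v2 (v2 |: A) * mu (v2 |: A).
  by under eq_bigr do rewrite mulrBl; rewrite sumrB !sum_delta.
have chi_neq0 F v : chi (F :\ v) != 0 -> v \in F ->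
    [/\ #|F| = #|A|.+1, A \subset F & v \notin A].
  rewrite /chi; case: (eqVneq (F :\ v) A) => [<- _ vF|]; last by rewrite eqxx.
  by rewrite (cardsD1 v F) vF add1n subD1set !inE eqxx.
have lamE v : v \notin A ->
    lam (v |: A) = (-1) ^+ below v (v |: A) * (v \in U)%:R.
  move=> vA; rewrite /lam (bigD1 v) ?setU11 //= setU1K // /chi eqxx mulr1.
  rewrite big1 ?addr0 // => h /andP[hF hv].
  case: eqP => [hA|]; rewrite ?mulr0 //.
  have /setP/(_ h) := hA; move: hF; rewrite !inE eqxx (negPf hv) /= => ->.
  by [].
exists lam, alpha; split; last first.
- rewrite alphaE !lamE // v1U (negPf v2U) !mulr0 subr0 mulr1 -expr2 sqrr_sign.
  exact: oner_neq0.
- move=> mu [beta [eta [hbeta heta hmu]]].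
  have muE v C : v \notin A -> v \notin C -> mincover e C -> [disjoint C & A] ->
      (\sum_(i in C) b i < l)%N ->
      mu (v |: A) = (-1) ^+ below v (v |: A) * beta A.
    move=> vA vC cC CA bC; rewrite hmu (codiff_single (setU11 v A)).
      rewrite setU1K //; suff -> : eta (v |: A) = 0 by rewrite addr0.
      apply/eqP; apply: contraT => /heta[_ /in_locP[_ /(_ C cC)]].
      by rewrite disjoint_setU1 vC CA leqNgt bC => /(_ isT).
    move=> h; rewrite in_setU1 => /orP[/eqP ->|hA _]; first by rewrite eqxx.
    apply/eqP; apply: contraT => /hbeta[_ /subsetP/(_ h hA)].
    by rewrite !inE eqxx.
  rewrite alphaE (muE v1 C1) // (muE v2 C2) // !mulrA -!expr2 !sqrr_sign.
  by rewrite subrr.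
split=> F.
  move=> lamF; have [v vF] : exists2 v, v \in F & chi (F :\ v) != 0.
    apply: contrapT => /forall2NP h; case/eqP: lamF; apply: big1 => v vF.
    by case: (h v) => // /negP; rewrite negbK => /eqP ->; rewrite !mulr0.
  by move=> /chi_neq0/(_ vF)[].
move=> Fj; apply: contraNT => /negP nloc.
have [AF|AF] := boolP (A \subset F); last first.
  rewrite codiff_eq0 // => i iF; apply: big1 => v; rewrite !inE => /andP[vi vF].
  have [->|/chi_neq0] := eqVneq (chi (F :\ i :\ v)) 0; first by rewrite !mulr0.
  rewrite !inE vi vF => /(_ isT)[_ AFi _].
  by case/negP: AF; apply: subset_trans AFi (subD1set _ _).
have [C [cC CF bC]] : exists C, [/\ mincover e C, [disjoint C & F]
    & (\sum_(i in C) b i < l)%N].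
  apply: contrapT => h; apply: nloc; apply/in_locP; split=> // C cC CF.
  by rewrite leqNgt; apply/negP => bC; apply: h; exists C.
(* On the facet ~: C the indicator of U is constant, so there [lam] is a multiple of the coboundary
   of [chi] and its own coboundary vanishes. *)
have [kappa hkappa] : exists kappa : bool,
    forall v, v \notin C :|: A -> (v \in U) = kappa.
  have [h|h] := hU C cC (disjointWr AF CF) bC.
    by exists true => v /h.
  by exists false => v /h/negPf.
rewrite (_ : codiff lam F = kappa%:R * codiff (codiff chi) F).
  by rewrite codiff_codiff mulr0.
rewrite -codiffZ; apply: eq_bigr => i iF; congr (_ * _).
rewrite -codiffZ; apply: eq_bigr => v.
rewrite !inE => /andP[vi vF]; congr (_ * _).
have [->|/chi_neq0] := eqVneq (chi (F :\ i :\ v)) 0; first by rewrite !mulr0.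
rewrite !inE vi vF => /(_ isT)[_ _ vA].
by rewrite hkappa // !inE negb_or vA (disjointFl CF vF).
Qed.

End Detection.

(** * The lower bound for dim K^j *)

Section LowerBound.
Variables (k : fieldType) (n : nat).
Notation S := {mpoly k[n]}.
Variables (e : rel 'I_n) (l : nat) (J : {pred S}).
Implicit Types (A : {set 'I_n}) (b : 'I_n -> nat).
Hypothesis JE : J =i mon_ideal (sym_mon e l).

Lemma eq_graded_cocycle j A b b' (lam : {set 'I_n} -> k) :
  (forall i, i \notin A -> b i = b' i) ->
  graded_cocycle e j l A b lam -> graded_cocycle e j l A b' lam.
Proof.
move=> bb' [h1 h2]; split=> // F Fj /(h2 F Fj).
by rewrite (eq_in_loc _ _ _ bb').
Qed.

Lemma eq_graded_coboundary j A b b' (lam : {set 'I_n} -> k) :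
  (forall i, i \notin A -> b i = b' i) ->
  graded_coboundary e j l A b lam -> graded_coboundary e j l A b' lam.
Proof.
move=> bb' [beta [eta [h1 h2 h3]]]; exists beta, eta; split=> // F /h2.
by rewrite (eq_in_loc _ _ _ bb').
Qed.

(** Suppose s has a term m in the variables of A only. Place [lam] in a degree u - T, and let phi
    apply [alpha] to the coefficients at u + m - T: on s times this cocycle phi takes the value s_m
    times the pairing of [alpha] with [lam], which is nonzero. *)
Lemma ann_canonical_dual_sub j A b : detected e k j l A b ->
  {subset ann_canonical_dual J j%:Z <= var_power (~: A) 1}.
Proof.
case=> lam [alpha [lam_cocycle alpha0 alpha_lam]] s s_ann.
apply/mon_idealP => m sm; apply: contraTT s_ann; rewrite -leqNgt leqn0 => m0.
have mA i : i \notin A -> m i = 0%N.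
  move=> iA; have := leq_mdegin m (_ : i \in ~: A); rewrite inE (eqP m0).
  by move=> /(_ iA); rewrite leqn0 => /eqP.
have mT i : (m i < (mdeg m).+1)%N by rewrite ltnS mdegE (bigD1 i) //= leq_addr.
(* T exceeds every exponent of m, so the negative support is still A after multiplication by x^m. *)
pose T := (mdeg m).+1.
pose u : 'X_{1..n} := [multinom if i \in A then 0%N else (b i + T)%N | i < n].
have uE i : u i = if i \in A then 0%N else (b i + T)%N by rewrite mnmE.
have negu : neg_part u T = A.
  by apply/setP => i; rewrite inE uE; case: (i \in A) => //; lia.
have negum : neg_part (u + m) T = A.
  apply/setP => i; rewrite inE mnmDE uE; case: (boolP (i \in A)) => [_|/mA ->].
    exact: mT.
  lia.
have posu i : i \notin A -> b i = pos_part u T i.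
  by move=> iA; rewrite /pos_part uE (negPf iA) addnK.
have posum i : i \notin A -> pos_part (u + m) T i = b i.
  by move=> iA; rewrite /pos_part mnmDE uE (negPf iA) mA // addn0 addnK.
pose phi (c : cochain k n) := \sum_F alpha F * lcoeff (u + m) T (c F).
have cocycle_laurent c F : cocycle J j%:Z c -> is_laurent (c F).
  by case=> hc _; exact: cech_laurent hc.
have phi_dual : in_canonical_dual J j%:Z phi.
  split.
  - move=> a c c' hc hc'; rewrite /phi mulr_sumr -big_split.
    apply: eq_bigr => F _.
    rewrite !ffunE lcoeffD; last exact: cocycle_laurent.
      by rewrite lcoeffZ ?mulrDr 1?mulrCA //; exact: cocycle_laurent.
    by apply: is_laurentM; exact: cocycle_laurent.
  - move=> c /(coboundary_lcoeff JE (u + m) T); rewrite negum => hc.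
    by apply: alpha0; apply: eq_graded_coboundary hc.
  exists (mdeg (u + m) + n * T)%N => d c hd hc chomog.
  apply: big1 => F _; apply/eqP; rewrite mulf_eq0 -implyNb.
  apply/implyP => _; apply: contraT => /(lcoeff_neq0_homog (chomog F)).
  by move: hd; lia.
have c_cocycle : cocycle J j%:Z (mono_cochain u T lam).
  apply: (cocycle_mono JE); rewrite negu.
  exact: eq_graded_cocycle lam_cocycle.
apply/negP => /asboolP/(_ phi phi_dual _ c_cocycle); rewrite /phi.
have E F : alpha F * lcoeff (u + m) T (cscale s (mono_cochain u T lam) F) =
    alpha F * lam F * s@_m.
  rewrite !ffunE mulrCA -laurentM lcoeffZ; last by do 2!eexists.
  by rewrite lcoeff_same mcoeffMX mulrA.
under eq_bigr do rewrite E; rewrite -mulr_suml.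
by apply/eqP; rewrite mulf_neq0.
Qed.

(** Adjoining the variables of A one at a time to those off A gives a strict chain of |A| + 1
    primes. *)
Lemma krull_dim_ge_var_power (A : {set 'I_n}) (P : {pred S}) (a : int) :
  a <= #|A|%:Z -> {subset P <= var_power (~: A) 1} -> krull_dim_ge P a.
Proof.
move=> aA hP; pose C i : {set 'I_n} := ~: A :|: [set x in take i (enum A)].
have sub i j : (i <= j)%N ->
    {subset var_power (C i) 1 <= var_power (k := k) (C j) 1}.
  move=> ij; apply: var_power1_sub => [|x].
    by have [] := prime_var_power1 k (C j).
  rewrite mon_idealX mdeginU => xC; suff -> : x \in C j by [].
  move: xC; rewrite !inE => /orP[->//|xi]; apply/orP; right.
  by apply: mem_subseq xi; rewrite -(take_takel _ ij) take_subseq.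
exists #|A|, (fun i => var_power (C i) 1); split=> // i iA.
  split; first exact: prime_var_power1.
  move=> p /hP; suff -> : ~: A = C 0%N by apply: sub.
  by apply/setP => x; rewrite /C take0 !inE orbF.
split; first exact: sub.
have iA' : (i < size (enum A))%N by rewrite -cardE.
have [x0 _] : exists x0, x0 \in A by apply/card_gt0P; exact: leq_ltn_trans iA.
pose x := nth x0 (enum A) i.
move=> /(_ 'X_x); rewrite !mon_idealX !mdeginU.
have -> : x \in C i.+1.
  by rewrite !inE (take_nth x0) // mem_rcons mem_head orbT.
suff -> : (x \in C i) = false by move=> /(_ isT).
rewrite !inE -mem_enum mem_nth //=; apply/negP => /(nthP x0)[h].
rewrite size_take iA' => hi; rewrite nth_take // => /eqP.
by rewrite nth_uniq ?enum_uniq // ?(ltn_trans hi) // ltn_eqF.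
Qed.

End LowerBound.

Lemma leq_bigmin (n x : nat) (P Q : pred 'I_n) : subpred Q P ->
  (\big[minn/x]_(j < n | P j) j <= \big[minn/x]_(j < n | Q j) j)%N.
Proof.
move=> QP; elim: (index_enum _) => [|j r IHr]; first by rewrite !big_nil.
rewrite !big_cons; case: ifP => [_|/negP nP].
  case: ifP => _; last by rewrite geq_min IHr orbT.
  by rewrite leq_min geq_minl geq_min IHr orbT.
by case: ifP => // /QP.
Qed.

Theorem theorem1p10 (k : fieldType) (n : nat) (e : rel 'I_n)
    (e_sym : symmetric e) (e_irr : irreflexive e)
    (e_wc : well_covered e) (l : nat) (l_ge1 : (1 <= l)%N) :
  (Sr_depth (symbolic_power (edge_ideal k e) l.+1) 2
     <= Sr_depth (symbolic_power (edge_ideal k e) l) 2)%N.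
Proof.
have JE i := @symbolic_powerE k n e e_sym e_irr i.
apply: leq_bigmin => j /asboolP dim_j; apply/asboolP.
case: (krull_dim_ge_data (JE l) dim_j) => -[A Aj].
  move/(facet_detected k (ltn0Sn l)); rewrite Aj.
  move/(ann_canonical_dual_sub (JE l.+1)) => h.
  by apply: krull_dim_ge_var_power h; lia.
move/(disconnected_degreeS e_sym e_irr)/(disconnected_detected k) => [b].
rewrite Aj => /(ann_canonical_dual_sub (JE l.+1)) => h.
by apply: krull_dim_ge_var_power h; lia.
Qed.
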